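(* The mapping $B\mapsto\mathcal{K}_B$ on objects, together with the substitution functors $\Delta_b:\mathcal{K}_B\to\mathcal{K}_J$ for $b:J\to B$ in $\mathbf{QBS}$, defines a pseudo functor $\mathcal{K}:\mathbf{QBS}^{\mathrm{op}}\to\mathbf{Cat}$. Applying the Grothendieck construction to this indexed category yields a fibration $\int\mathcal{K}\to\mathbf{QBS}$.
   Context: Let $\mathbb{I}=[0,1]$ with its Borel $\sigma$-algebra $\Sigma_{\mathbb{I}}$, and let $\upsilon$ be the uniform probability measure on $\mathbb{I}$. A quasi-Borel space is a pair $(X,M_X)$ of a set $X$ and a set $M_X$ of functions $\mathbb{I}\to X$ (random elements) such that: (1) every constant function is in $M_X$; (2) if $f:\mathbb{I}\to\mathbb{I}$ is measurable and $\rho\in M_X$ then $\rho\circ f\in M_X$; (3) if $\mathbb{I}=\coprod_{i\in\mathbb{N}}S_i$ with each $S_i\in\Sigma_{\mathbb{I}}$ and $\alpha_i\in M_X$ for each $i$, then the function equal to $\alpha_i$ on $S_i$ is in $M_X$. A morphism $(X,M_X)\to(Y,M_Y)$ is a function $f$ with $f\circ\rho\in M_Y$ for all $\rho\in M_X$; these form the category $\mathbf{QBS}$. Each $(X,M_X)$ has the $\sigma$-algebra $\Sigma_X=\{U\subseteq X\mid \forall\alpha\in M_X.\ \alpha^{-1}(U)\in\Sigma_{\mathbb{I}}\}$. A probability measure on $(X,M_X)$ is an equivalence class of random elements under equality of the pushforward measures $\alpha_*\upsilon:U\mapsto\upsilon(\alpha^{-1}(U))$ on $(X,\Sigma_X)$.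 The set $P(X)=\{\alpha_*\upsilon\mid\alpha\in M_X\}$ is a quasi-Borel space whose random elements are the $\beta:\mathbb{I}\to P(X)$ for which there is a morphism of quasi-Borel spaces $\alpha:\mathbb{I}\to M_X$ (where $M_X$ has its function-space quasi-Borel structure) with $\beta(r)=\alpha(r)_*\upsilon$ for all $r\in\mathbb{I}$. With $P(f)(\alpha_*\upsilon)=(f\circ\alpha)_*\upsilon$, $P$ is a (Giry-style) monad on $\mathbf{QBS}$. A kernel $k:X\rightsquigarrow Y$ is a morphism of the Kleisli category of $P$, i.e. a morphism $X\to P(Y)$ in $\mathbf{QBS}$; composition is $(k\circ h)(x)(U)=\int k(y)(U)\,h(x)(\mathrm{d}y)$ and identities are given by Dirac measures. For $f:X\to Y$ in $\mathbf{QBS}$, $\delta_f:X\rightsquigarrow Y$ is the deterministic kernel sending $x$ to the Dirac measure at $f(x)$. For a quasi-Borel space $B$, the category $\mathcal{K}_B$ has as objects the pairs $(E,p)$ with $p:E\to B$ a morphism in $\mathbf{QBS}$; a morphism $(E,p)\rightsquigarrow(E',p')$ is a kernel over $B$, i.e. a kernel $k:E\rightsquigarrow E'$ with $\delta_{p'}\circ k=\delta_p$; composition and identities are those of the Kleisli category. The fibre of $p:E\to B$ over $b:J\to B$ is the pullback $p[b]=\{(j,e)\in J\times E\mid b(j)=p(e)\}$ in $\mathbf{QBS}$, with projections $b^*p:p[b]\to J$ and $\pi_E:p[b]\to E$. Fibrewise restriction: for a kernel $k:(E,p)\rightsquigarrow(E',p')$ over $B$ and $b:J\to B$, the kernel $k[b]:p[b]\rightsquigarrow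 p'[b]$ is given by $x\mapsto k(\pi_E(x))$, regarded as a measure on $p'[b]$: for $x\in p[b]$ and $j=b^*p(x)$, the measure $k[b](x)$ is represented by the random element $r\mapsto(j,\alpha(r))$ of $p'[b]$, where $\alpha\in M_{E'}$ represents $k(\pi_E(x))$ and takes values in the fibre of $p'$ over $b(j)$. Substitution functor: $\Delta_b:\mathcal{K}_B\to\mathcal{K}_J$ maps $E\xrightarrow{p}B$ to $p[b]\xrightarrow{b^*p}J$ and a morphism $k$ to $k[b]$.
   Formalization: The base category QBS is replaced by its full subcategory of spaces B whose diagonal lies in Σ_{B×B} (total spaces E stay arbitrary): over B={0,1} with all functions as random elements, a kernel over B may have no restriction k[b], so Δ_b is undefined. *)

(* Defs.v *)
From HB Require Import structures.
From mathcomp Require Import all_boot all_order all_algebra.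
From mathcomp Require Import all_classical all_reals all_analysis.
Import Order.TTheory GRing.Theory Num.Theory.

Set Implicit Arguments.
Unset Strict Implicit.
Unset Printing Implicit Defensive.

Local Open Scope classical_set_scope.
Local Open Scope ring_scope.

(* Structures are split into the data they are carried by (objects and
   hom-types, object maps) and the remaining structure and laws, so that one can
   speak of category structures on prescribed hom-types, and of functors
   with a prescribed action on objects, up to conversion. *)

Record category_on (ob : Type) (mor : ob -> ob -> Type) := CategoryOn {
  idm_ : forall x, mor x x;
  ccomp_ : forall x y z, mor y z -> mor x y -> mor x z;
  comp_idl_ : forall x y (f : mor x y), ccomp_ (idm_ y) f = f;
  comp_idr_ : forall x y (f : mor x y), ccomp_ f (idm_ x) = f;
  compA_ : forall x y z w (h : mor z w) (g : mor y z) (f : mor x y),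
    ccomp_ h (ccomp_ g f) = ccomp_ (ccomp_ h g) f }.

Record category := Category {
  ob :> Type;
  mor : ob -> ob -> Type;
  cat_str : category_on mor }.

Arguments mor {c} x y.

Definition idm (C : category) (x : C) : mor x x := idm_ (cat_str C) x.
Arguments idm {C} x.
Definition ccomp (C : category) (x y z : C) (g : mor y z) (f : mor x y) :
  mor x z := ccomp_ (cat_str C) g f.

Notation "g '\oc' f" := (ccomp g f) (at level 40, left associativity).

Lemma comp_idl (C : category) (x y : C) (f : mor x y) : idm y \oc f = f.
Proof. exact: comp_idl_. Qed.
Lemma comp_idr (C : category) (x y : C) (f : mor x y) : f \oc idm x = f.
Proof. exact: comp_idr_. Qed.
Lemma compA (C : category) (x y z w : C) (h : mor z w) (g : mor y z)
  (f : mor x y) : h \oc (g \oc f) = (h \oc g) \oc f.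
Proof. exact: compA_. Qed.

Definition is_iso (C : category) (x y : C) (f : mor x y) : Prop :=
  exists g : mor y x, g \oc f = idm x /\ f \oc g = idm y.

Definition eq_hom (C : category) (x y : C) (e : x = y) : mor x y :=
  match e in _ = y' return mor x y' with erefl => idm x end.

Definition opcat (C : category) : category :=
  @Category C (fun x y => @mor C y x)
    (@CategoryOn C (fun x y => @mor C y x) (@idm C)
      (fun x y z g f => f \oc g)
      (fun x y f => comp_idr f) (fun x y f => comp_idl f)
      (fun x y z w h g f => esym (compA f g h))).

Definition full_subcat (C : category) (P : C -> Prop) : category :=
  @Category {x : C | P x} (fun x y => @mor C (sval x) (sval y))
    (@CategoryOn {x : C | P x} (fun x y => @mor C (sval x) (sval y))
      (fun x => idm (sval x))
      (fun x y z g f => g \oc f)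
      (fun x y f => comp_idl f) (fun x y f => comp_idr f)
      (fun x y z w h g f => compA h g f)).

Record functor_on (C D : category) (fob : C -> D) := FunctorOn {
  fmap_ : forall x y, mor x y -> mor (fob x) (fob y);
  fmap_id_ : forall x, fmap_ (idm x) = idm (fob x);
  fmap_comp_ : forall x y z (g : mor y z) (f : mor x y),
    fmap_ (g \oc f) = fmap_ g \oc fmap_ f }.

Record functor (C D : category) := Functor {
  fob :> C -> D;
  fun_str : functor_on fob }.

Definition fmap (C D : category) (F : functor C D) (x y : C) (f : mor x y) :
  mor (F x) (F y) := fmap_ (fun_str F) f.

Lemma fmap_id (C D : category) (F : functor C D) (x : C) :
  fmap F (idm x) = idm (F x).
Proof. exact: fmap_id_. Qed.
Lemma fmap_comp (C D : category) (F : functor C D) (x y z : C)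
  (g : mor y z) (f : mor x y) : fmap F (g \oc f) = fmap F g \oc fmap F f.
Proof. exact: fmap_comp_. Qed.

Definition id_functor (C : category) : functor C C :=
  @Functor C C id (@FunctorOn C C id (fun x y f => f)
    (fun x => erefl) (fun x y z g f => erefl)).

Lemma comp_functor_id (C D E : category) (G : functor D E) (F : functor C D)
  (x : C) : fmap G (fmap F (idm x)) = idm (G (F x)).
Proof. by rewrite !fmap_id. Qed.
Lemma comp_functor_comp (C D E : category) (G : functor D E) (F : functor C D)
  (x y z : C) (g : mor y z) (f : mor x y) :
  fmap G (fmap F (g \oc f)) = fmap G (fmap F g) \oc fmap G (fmap F f).
Proof. by rewrite !fmap_comp. Qed.

Definition comp_functor (C D E : category) (G : functor D E)
    (F : functor C D) : functor C E :=
  @Functor C E (fun x => G (F x)) (@FunctorOn C E (fun x => G (F x))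
    (fun x y f => fmap G (fmap F f))
    (comp_functor_id G F) (comp_functor_comp G F)).

Record nat_iso (C D : category) (F G : functor C D) := NatIso {
  nat_cpt :> forall x : C, mor (F x) (G x);
  nat_cpt_iso : forall x, is_iso (nat_cpt x);
  nat_natural : forall x y (f : mor x y),
    nat_cpt y \oc fmap F f = fmap G f \oc nat_cpt x }.

(* Pseudofunctors [C -> Cat] acting by [F0] on objects and whose reindexing
   functors act by [Fo] on objects; [C] has only identity 2-cells.  In the
   coherence laws [ps_eq e] is the component of the identity
   [F f = F g] coming from an equation [e : f = g] between arrows of [C]. *)
Section Pseudofunctor.
Variables (C : category) (F0 : C -> category).
Variable Fo : forall x y : C, mor x y -> F0 x -> F0 y.

Definition ps_eq (x y : C) (f g : mor x y) (e : f = g) (E : F0 x) :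
  mor (Fo f E) (Fo g E) := eq_hom (congr1 (fun h => Fo h E) e).

Record pseudofunctor_on := PseudofunctorOn {
  ps_str : forall (x y : C) (f : mor x y), functor_on (Fo f);
  ps_fun := fun (x y : C) (f : mor x y) => Functor (ps_str f);
  ps_unit : forall x : C, nat_iso (id_functor (F0 x)) (ps_fun (idm x));
  ps_mult : forall (x y z : C) (g : mor y z) (f : mor x y),
    nat_iso (comp_functor (ps_fun g) (ps_fun f)) (ps_fun (g \oc f));
  ps_unitl : forall (x y : C) (f : mor x y) (E : F0 x),
    ps_eq (comp_idl f) E \oc (ps_mult (idm y) f E \oc ps_unit y (Fo f E))
    = idm (Fo f E);
  ps_unitr : forall (x y : C) (f : mor x y) (E : F0 x),
    ps_eq (comp_idr f) E \oc (ps_mult f (idm x) E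
      \oc fmap (ps_fun f) (ps_unit x E))
    = idm (Fo f E);
  ps_assoc : forall (x y z w : C) (h : mor z w) (g : mor y z) (f : mor x y)
      (E : F0 x),
    ps_eq (compA h g f) E \oc (ps_mult h (g \oc f) E
      \oc fmap (ps_fun h) (ps_mult g f E))
    = ps_mult (h \oc g) f E \oc ps_mult h g (Fo f E) }.

End Pseudofunctor.

Section Grothendieck.
Variables (C : category) (F0 : opcat C -> category).
Variable Fo : forall x y : opcat C, mor x y -> F0 x -> F0 y.
Variable F : pseudofunctor_on Fo.

Definition groth_ob : Type := {x : C & F0 x}.

Definition groth_hom (X Y : groth_ob) : Type :=
  {f : @mor C (projT1 X) (projT1 Y) &
     @mor (F0 (projT1 X)) (projT2 X) (@Fo (projT1 Y) (projT1 X) f (projT2 Y))}.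

Definition groth_id (X : groth_ob) : groth_hom X X :=
  existT _ (idm (projT1 X)) (ps_unit F (projT1 X) (projT2 X)).

Definition groth_comp (X Y Z : groth_ob) (g : groth_hom Y Z)
    (f : groth_hom X Y) : groth_hom X Z :=
  existT _ (@ccomp C _ _ _ (projT1 g) (projT1 f))
    (@ps_mult _ _ _ F (projT1 Z) (projT1 Y) (projT1 X) (projT1 f) (projT1 g)
       (projT2 Z)
     \oc (fmap (@ps_fun _ _ _ F (projT1 Y) (projT1 X) (projT1 f)) (projT2 g)
     \oc projT2 f)).

Lemma groth_hom_eq (X Y : groth_ob)
    (f g : @mor (opcat C) (projT1 Y) (projT1 X))
    (k : @mor (F0 (projT1 X)) (projT2 X) (Fo f (projT2 Y)))
    (l : @mor (F0 (projT1 X)) (projT2 X) (Fo g (projT2 Y)))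
    (e : f = g) :
  ps_eq Fo e (projT2 Y) \oc k = l ->
  existT _ f k = existT _ g l :> groth_hom X Y.
Proof. by case: _ / e l => l /=; rewrite comp_idl => ->. Qed.

Lemma ps_eq_natural (x y : opcat C) (f g : mor x y) (e : f = g)
    (E E' : F0 x) (k : mor E E') :
  ps_eq Fo e E' \oc fmap (ps_fun F f) k =
  fmap (ps_fun F g) k \oc ps_eq Fo e E.
Proof. by case: _ / e => /=; rewrite comp_idl comp_idr. Qed.

Lemma ps_eqK (x y : opcat C) (f g : mor x y) (e : f = g) (e' : g = f)
    (E : F0 x) : ps_eq Fo e' E \oc ps_eq Fo e E = idm _.
Proof.
by case: _ / e e' => e'; rewrite (Prop_irrelevance e' erefl) /= comp_idl.
Qed.

Lemma groth_idl (X Y : groth_ob) (f : groth_hom X Y) :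
  groth_comp (groth_id Y) f = f.
Proof.
case: f => f k; rewrite /groth_comp /groth_id /=.
apply: (groth_hom_eq (e := @comp_idr (opcat C) _ _ f)) => /=.
have H := @ps_unitr _ _ _ F _ _ f (projT2 Y).
by rewrite !compA -(compA (ps_eq _ _ _)) H comp_idl.
Qed.

Lemma groth_idr (X Y : groth_ob) (f : groth_hom X Y) :
  groth_comp f (groth_id X) = f.
Proof.
case: f => f k; rewrite /groth_comp /groth_id /=.
apply: (groth_hom_eq (e := @comp_idl (opcat C) _ _ f)) => /=.
have H := @ps_unitl _ _ _ F _ _ f (projT2 Y).
have /= N := nat_natural (ps_unit F (projT1 X)) k.
by rewrite -N !compA -(compA (ps_eq _ _ _)) H comp_idl.
Qed.

Lemma groth_aux (D : category) (x1 x2 x3 x4 x5 x6 x7 x8 : D)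
    (a : mor x6 x7) (b : mor x5 x6) (c : mor x4 x5) (d : mor x8 x7)
    (e : mor x4 x8) (p : mor x3 x4) (x9 : D) (q : mor x9 x8) (r : mor x3 x9)
    (l : mor x2 x3) (k : mor x1 x2) :
  a \oc (b \oc c) = d \oc e -> e \oc p = q \oc r ->
  a \oc (b \oc ((c \oc (p \oc l)) \oc k)) = d \oc (q \oc (r \oc (l \oc k))).
Proof.
move=> H N.
have -> : a \oc (b \oc ((c \oc (p \oc l)) \oc k)) =
  (a \oc (b \oc c)) \oc (p \oc (l \oc k)) by rewrite !compA.
by rewrite H !compA -(compA d e p) N !compA.
Qed.

Lemma groth_compA (X Y Z W : groth_ob) (h : groth_hom Z W)
    (g : groth_hom Y Z) (f : groth_hom X Y) :
  groth_comp h (groth_comp g f) = groth_comp (groth_comp h g) f.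
Proof.
case: f g h => [f k] [g l] [h m]; rewrite /groth_comp /=.
apply/esym.
apply: (groth_hom_eq (e := @compA (opcat C) _ _ _ _ f g h)) => /=.
have H := @ps_assoc _ _ _ F _ _ _ _ f g h (projT2 W).
have /= N := nat_natural (ps_mult F f g) m.
by rewrite 2!fmap_comp; exact: (groth_aux _ _ H N).
Qed.

Definition groth : category :=
  @Category groth_ob groth_hom (@CategoryOn groth_ob groth_hom
    groth_id groth_comp groth_idl groth_idr groth_compA).

Definition groth_proj : functor groth C :=
  @Functor groth C (fun X : groth_ob => projT1 X)
    (@FunctorOn groth C (fun X : groth_ob => projT1 X)
       (fun X Y (f : groth_hom X Y) => projT1 f)
       (fun X => erefl) (fun X Y Z g f => erefl)).

End Grothendieck.

Definition cartesian (E B : category) (P : functor E B) (X Y : E)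
    (f : mor X Y) : Prop :=
  forall (Z : E) (g : mor Z Y) (u : mor (P Z) (P X)),
    fmap P f \oc u = fmap P g ->
    exists! h : mor Z X, fmap P h = u /\ f \oc h = g.

Definition is_fibration (E B : category) (P : functor E B) : Prop :=
  forall (Y : E) (b : B) (u : mor b (P Y)),
    exists (X : E) (e : P X = b) (f : mor X Y),
      fmap P f = u \oc eq_hom e /\ cartesian P f.

(* [unit_itv R] is [0,1] with the Borel sets, i.e. the traces of the Borel
   subsets of the real line. *)
Section UnitInterval.
Variable R : realType.

Definition unit_itv : Type := {x : R | 0 <= x <= 1}.

HB.instance Definition _ := Choice.on unit_itv.

Lemma unit_itv0 : 0 <= (0 : R) <= 1. Proof. by rewrite lexx ler01. Qed.

HB.instance Definition _ :=
  isPointed.Build unit_itv (exist (fun x : R => 0 <= x <= 1) 0 unit_itv0).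

Definition unit_itv_val (r : unit_itv) : R := sval r.

Definition unit_itv_measurable : set (set unit_itv) :=
  [set A | exists2 B : set (measurableTypeR R),
     measurable B & A = unit_itv_val @^-1` B].

Lemma unit_itv_measurable0 : unit_itv_measurable set0.
Proof. by exists set0 => //; rewrite preimage_set0. Qed.

Lemma unit_itv_measurableC (A : set unit_itv) :
  unit_itv_measurable A -> unit_itv_measurable (~` A).
Proof.
by move=> [B mB ->]; exists (~` B); [exact: measurableC|rewrite preimage_setC].
Qed.

Lemma unit_itv_measurable_bigcup (A : (set unit_itv)^nat) :
  (forall i, unit_itv_measurable (A i)) ->
  unit_itv_measurable (\bigcup_i A i).
Proof.
move=> mA; pose B i := s2val (cid2 (mA i)).
have mB i : measurable (B i) by rewrite /B; case: (cid2 (mA i)).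
have AB i : A i = @unit_itv_val @^-1` B i by rewrite /B; case: (cid2 (mA i)).
exists (\bigcup_i B i); first exact: bigcup_measurable.
by rewrite preimage_bigcup; apply: eq_bigcupr => i _; rewrite AB.
Qed.

Definition unit_itv_display : measure_display. Proof. by constructor. Qed.

HB.instance Definition _ := @isMeasurable.Build unit_itv_display unit_itv
  unit_itv_measurable unit_itv_measurable0 unit_itv_measurableC
  unit_itv_measurable_bigcup.

(* the uniform probability measure on [0,1]; [uniform_prob] is the library's
   uniform distribution on the real line supported by [0,1] *)
Definition upsilon (A : set unit_itv) : \bar R :=
  uniform_prob (@ltr01 R) (unit_itv_val @` A).

Lemma unit_itv_val_inj : injective unit_itv_val.
Proof. exact: val_inj. Qed.

Lemma unit_itv_image_measurable (A : set unit_itv) :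
  measurable A -> measurable (unit_itv_val @` A : set (measurableTypeR R)).
Proof.
move=> [B mB ->]; have -> : unit_itv_val @` (unit_itv_val @^-1` B) = B `&` `[0, 1].
  apply/seteqP; split=> [_ [[x x01] Bx <-]|x [Bx]]; rewrite /= in_itv //=.
  by move=> x01; exists (exist _ x x01).
by apply: measurableI => //; exact: measurable_itv.
Qed.

Lemma upsilon0 : upsilon set0 = 0%E.
Proof. by rewrite /upsilon image_set0 measure0. Qed.

Lemma upsilon_ge0 (A : set unit_itv) : (0 <= upsilon A)%E.
Proof. exact: measure_ge0. Qed.

Lemma upsilon_sigma_additive : semi_sigma_additive upsilon.
Proof.
move=> F mF tF mUF; rewrite /upsilon image_bigcup.
apply: (@measure_semi_sigma_additive _ _ _ (uniform_prob (@ltr01 R))).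
- by move=> i; exact: unit_itv_image_measurable.
- move=> i j _ _ [_ [[x Fx <-] [y Fy /unit_itv_val_inj yx]]].
  by apply: tF => //; exists x; split => //; rewrite -yx.
- by apply: bigcup_measurable => i _; exact: unit_itv_image_measurable.
Qed.

HB.instance Definition _ := isMeasure.Build _ _ _ upsilon
  upsilon0 upsilon_ge0 upsilon_sigma_additive.

Lemma upsilon_setT : upsilon setT = 1%E.
Proof.
rewrite /upsilon /uniform_prob.
have -> : unit_itv_val @` setT = [set` `[0, 1]%R].
  apply/seteqP; split=> [_ [[x x01] _ <-]|x]; rewrite /= in_itv //=.
  by move=> x01; exists (exist _ x x01).
by apply: integral_uniform_pdf1; rewrite ?ltr01.
Qed.

HB.instance Definition _ := Measure_isProbability.Build _ _ _ upsilon
  upsilon_setT.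

End UnitInterval.

Section QuasiBorel.
Variable R : realType.
Local Notation I := (unit_itv R).
Local Notation upsilon := (@upsilon R).

Record qbs := Qbs {
  carrier :> Type;
  rand : set (I -> carrier);
  rand_cst : forall x : carrier, rand (fun=> x);
  rand_comp : forall (f : I -> I) (rho : I -> carrier),
    measurable_fun setT f -> rand rho -> rand (rho \o f);
  rand_glue : forall (S : nat -> set I) (alpha : nat -> I -> carrier)
      (rho : I -> carrier),
    (forall i, measurable (S i)) -> trivIset setT S -> \bigcup_i S i = setT ->
    (forall i, rand (alpha i)) ->
    (forall i r, S i r -> rho r = alpha i r) ->
    rand rho }.

Record qbs_hom (X Y : qbs) := QbsHom {
  qbs_fun :> X -> Y;
  qbs_homP : forall rho, rand rho -> rand (qbs_fun \o rho) }.

Lemma qbs_hom_eq (X Y : qbs) (f g : qbs_hom X Y) :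
  (f : X -> Y) = g -> f = g.
Proof.
case: f g => [f pf] [g pg] /= fg; case: _ / fg pg => pg.
by rewrite (Prop_irrelevance pf pg).
Qed.

Definition qbs_id (X : qbs) : qbs_hom X X :=
  @QbsHom X X id (fun rho Mrho => Mrho).

Definition qbs_comp (X Y Z : qbs) (g : qbs_hom Y Z) (f : qbs_hom X Y) :
  qbs_hom X Z :=
  @QbsHom X Z (g \o f) (fun rho Mrho => qbs_homP g (qbs_homP f Mrho)).

Lemma qbs_idl (X Y : qbs) (f : qbs_hom X Y) : qbs_comp (qbs_id Y) f = f.
Proof. exact: qbs_hom_eq. Qed.
Lemma qbs_idr (X Y : qbs) (f : qbs_hom X Y) : qbs_comp f (qbs_id X) = f.
Proof. exact: qbs_hom_eq. Qed.
Lemma qbs_compA (X Y Z W : qbs) (h : qbs_hom Z W) (g : qbs_hom Y Z)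
  (f : qbs_hom X Y) : qbs_comp h (qbs_comp g f) = qbs_comp (qbs_comp h g) f.
Proof. exact: qbs_hom_eq. Qed.

Definition QBS : category :=
  @Category qbs qbs_hom (@CategoryOn qbs qbs_hom qbs_id qbs_comp
    qbs_idl qbs_idr qbs_compA).

Definition qbs_measurable (X : qbs) : set (set X) :=
  [set U | forall alpha, rand (q := X) alpha -> measurable (alpha @^-1` U)].

Lemma rand_itv_cst (x : I) : measurable_fun setT (fun _ : I => x).
Proof. exact: measurable_cst. Qed.

Lemma rand_itv_comp (f rho : I -> I) : measurable_fun setT f ->
  measurable_fun setT rho -> measurable_fun setT (rho \o f).
Proof. by move=> mf mrho; exact: measurableT_comp. Qed.

Lemma rand_itv_glue (S : nat -> set I) (alpha : nat -> I -> I) (rho : I -> I) :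
  (forall i, measurable (S i)) -> trivIset setT S -> \bigcup_i S i = setT ->
  (forall i, measurable_fun setT (alpha i)) ->
  (forall i r, S i r -> rho r = alpha i r) ->
  measurable_fun setT rho.
Proof.
move=> mS _ ST malpha rhoE _ A mA; rewrite setTI.
have -> : rho @^-1` A = \bigcup_i (S i `&` alpha i @^-1` A).
  apply/seteqP; split=> r /=.
    move=> Ar; have : (\bigcup_i S i) r by rewrite ST.
    by move=> [i _ Sir]; exists i => //; split=> //=; rewrite -rhoE.
  by move=> [i _ [Sir Ar]]; rewrite (rhoE _ _ Sir).
apply: bigcup_measurable => i _; apply: measurableI => //.
by rewrite -[X in measurable X]setTI; exact: malpha.
Qed.

Definition qbs_itv : qbs := @Qbs I [set f | measurable_fun setT f]
  rand_itv_cst rand_itv_comp rand_itv_glue.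

Section Product.
Variables X Y : qbs.

Definition prod_rand : set (I -> X * Y) :=
  [set rho | rand (fst \o rho) /\ rand (snd \o rho)].

Lemma prod_rand_cst (x : X * Y) : prod_rand (fun=> x).
Proof. by split; exact: rand_cst. Qed.

Lemma prod_rand_comp (f : I -> I) (rho : I -> X * Y) :
  measurable_fun setT f -> prod_rand rho -> prod_rand (rho \o f).
Proof.
by move=> mf [r1 r2]; split; [exact: (rand_comp mf r1)|exact: (rand_comp mf r2)].
Qed.

Lemma prod_rand_glue (S : nat -> set I) (alpha : nat -> I -> X * Y)
    (rho : I -> X * Y) :
  (forall i, measurable (S i)) -> trivIset setT S -> \bigcup_i S i = setT ->
  (forall i, prod_rand (alpha i)) ->
  (forall i r, S i r -> rho r = alpha i r) -> prod_rand rho.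
Proof.
move=> mS tS ST ra rhoE; split.
- apply: (rand_glue (alpha := fun i => fst \o alpha i) mS tS ST).
    by move=> i; case: (ra i).
  by move=> i r /rhoE /= ->.
- apply: (rand_glue (alpha := fun i => snd \o alpha i) mS tS ST).
    by move=> i; case: (ra i).
  by move=> i r /rhoE /= ->.
Qed.

Definition qbs_prod : qbs :=
  Qbs prod_rand_cst prod_rand_comp prod_rand_glue.

End Product.

Section Subspace.
Variables (X : qbs) (P : X -> Prop).

Definition sub_rand : set (I -> {x : X | P x}) :=
  [set rho | rand (fun r => sval (rho r))].

Lemma sub_rand_cst (x : {x : X | P x}) : sub_rand (fun=> x).
Proof. exact: rand_cst. Qed.

Lemma sub_rand_comp (f : I -> I) (rho : I -> {x : X | P x}) :
  measurable_fun setT f -> sub_rand rho -> sub_rand (rho \o f).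
Proof. by move=> mf rr; exact: (rand_comp mf rr). Qed.

Lemma sub_rand_glue (S : nat -> set I) (alpha : nat -> I -> {x : X | P x})
    (rho : I -> {x : X | P x}) :
  (forall i, measurable (S i)) -> trivIset setT S -> \bigcup_i S i = setT ->
  (forall i, sub_rand (alpha i)) ->
  (forall i r, S i r -> rho r = alpha i r) -> sub_rand rho.
Proof.
move=> mS tS ST ra rhoE.
apply: (rand_glue (alpha := fun i r => sval (alpha i r)) mS tS ST) => //.
by move=> i r /rhoE /= ->.
Qed.

Definition qbs_sub : qbs := Qbs sub_rand_cst sub_rand_comp sub_rand_glue.

End Subspace.

(* the function space [Y^X]: [rho] is random when its uncurrying
   [I * X -> Y] is a morphism *)
Section FunctionSpace.
Variables X Y : qbs.

Definition exp_rand : set (I -> qbs_hom X Y) :=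
  [set rho | forall s : I -> I * X, rand (q := qbs_prod qbs_itv X) s ->
     rand (fun r => rho (s r).1 (s r).2)].

Lemma exp_rand_cst (f : qbs_hom X Y) : exp_rand (fun=> f).
Proof. by move=> s [_ s2]; exact: (qbs_homP f s2). Qed.

Lemma exp_rand_comp (f : I -> I) (rho : I -> qbs_hom X Y) :
  measurable_fun setT f -> exp_rand rho -> exp_rand (rho \o f).
Proof.
move=> mf rr s [s1 s2]; apply: (rr (fun r => (f (s r).1, (s r).2))); split=> //=.
exact: (measurableT_comp mf s1).
Qed.

Lemma exp_rand_glue (S : nat -> set I) (alpha : nat -> I -> qbs_hom X Y)
    (rho : I -> qbs_hom X Y) :
  (forall i, measurable (S i)) -> trivIset setT S -> \bigcup_i S i = setT ->
  (forall i, exp_rand (alpha i)) ->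
  (forall i r, S i r -> rho r = alpha i r) -> exp_rand rho.
Proof.
move=> mS tS ST ra rhoE s [s1 s2].
pose T i := (fst \o s) @^-1` S i.
apply: (rand_glue (S := T) (alpha := fun i r => alpha i (s r).1 (s r).2)).
- by move=> i; rewrite -[X in measurable X]setTI; exact: s1.
- apply/trivIsetP => i j _ _ ij; rewrite -preimage_setI.
  by move/trivIsetP : tS => /(_ i j Logic.I Logic.I ij) ->; rewrite preimage_set0.
- by rewrite -preimage_bigcup ST preimage_setT.
- by move=> i; exact: ra.
- by move=> i r /rhoE ->.
Qed.

Definition qbs_exp : qbs := Qbs exp_rand_cst exp_rand_comp exp_rand_glue.

End FunctionSpace.

(* [M_X] with its function-space structure; as a set, the morphisms
   [I -> X] are exactly the random elements of [X] *)
Definition qbs_rand (X : qbs) : qbs := qbs_exp qbs_itv X.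

Lemma rand_hom (X : qbs) (alpha : I -> X) :
  rand alpha <-> exists f : qbs_rand X, alpha = f.
Proof.
split=> [ra|[f ->]]; last by apply: (qbs_homP f (rho := id)); exact: measurable_id.
by exists (@QbsHom qbs_itv X alpha (fun f mf => rand_comp mf ra)).
Qed.

(* [pushf alpha] is the pushforward of [upsilon] along [alpha], as a measure on
   the sigma-algebra of [X].  Set functions being defined on all sets, we
   fix the value 0 outside the sigma-algebra, so that equality of set
   functions is equality of measures. *)
Definition pushf (X : qbs) (alpha : I -> X) (U : set X) : \bar R :=
  if pselect (qbs_measurable U) then upsilon (alpha @^-1` U) else 0%E.

Lemma pushfE (X : qbs) (alpha : I -> X) (U : set X) :
  qbs_measurable U -> pushf alpha U = upsilon (alpha @^-1` U).
Proof. by rewrite /pushf; case: pselect. Qed.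

Record prob (X : qbs) := Prob {
  prob_fun :> set X -> \bar R;
  probP : exists2 alpha, rand alpha & prob_fun = pushf alpha }.

Lemma prob_eq (X : qbs) (mu nu : prob X) :
  (mu : set X -> \bar R) = nu -> mu = nu.
Proof.
case: mu nu => [m pm] [n pn] /= mn; case: _ / mn pn => pn.
by rewrite (Prop_irrelevance pm pn).
Qed.

Section ProbabilityMonad.
Variable X : qbs.

Definition prob_rand : set (I -> prob X) :=
  [set beta | exists alpha : qbs_hom qbs_itv (qbs_rand X),
     forall r, beta r = pushf (alpha r) :> (set X -> \bar R)].

Lemma prob_rand_cst (mu : prob X) : prob_rand (fun=> mu).
Proof.
have [alpha /rand_hom[f ->] muE] := probP mu.
exists (@QbsHom qbs_itv (qbs_rand X) (fun=> f)
  (fun _ _ => @rand_cst (qbs_rand X) f)) => r.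
exact: muE.
Qed.

Lemma prob_rand_comp (f : I -> I) (beta : I -> prob X) :
  measurable_fun setT f -> prob_rand beta -> prob_rand (beta \o f).
Proof.
move=> mf [alpha betaE].
exists (qbs_comp alpha (@QbsHom qbs_itv qbs_itv f
  (fun g mg => measurableT_comp mf mg))) => r.
exact: betaE.
Qed.

Lemma prob_rand_glue (S : nat -> set I) (alpha : nat -> I -> prob X)
    (rho : I -> prob X) :
  (forall i, measurable (S i)) -> trivIset setT S -> \bigcup_i S i = setT ->
  (forall i, prob_rand (alpha i)) ->
  (forall i r, S i r -> rho r = alpha i r) -> prob_rand rho.
Proof.
move=> mS tS ST ra rhoE.
pose a i := sval (cid (ra i)).
have aE i r : alpha i r = pushf (a i r) :> (set X -> \bar R).
  by rewrite /a; case: (cid (ra i)).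
have idx r : exists i, S i r.
  by have : (\bigcup_i S i) r; [rewrite ST|move=> [i _ Sir]; exists i].
pose n r := sval (cid (idx r)).
have Sn r : S (n r) r by rewrite /n; case: (cid (idx r)).
have nE i r : S i r -> n r = i.
  move=> Sir; apply: contrapT => ni.
  by move/trivIsetP : tS => /(_ (n r) i Logic.I Logic.I);
    move=> /(_ (introN eqP ni))/seteqP[+ _] => /(_ r); exact.
have ran : rand (q := qbs_rand X) (fun r => a (n r) r).
  apply: (rand_glue (alpha := fun i r => a i r) mS tS ST).
    move=> i; have /= := qbs_homP (a i) (rho := id); apply.
    exact: measurable_id.
  by move=> i r /nE ->.
exists (@QbsHom qbs_itv (qbs_rand X) (fun r => a (n r) r)
  (fun f mf => rand_comp mf ran)) => r /=.
by rewrite (rhoE _ _ (Sn r)) aE.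
Qed.

Definition qbs_P : qbs := Qbs prob_rand_cst prob_rand_comp prob_rand_glue.

End ProbabilityMonad.

Definition qbs_kernel (X Y : qbs) : Type := qbs_hom X (qbs_P Y).

Definition dirac_prob (X : qbs) (x : X) : prob X :=
  @Prob X (pushf (fun=> x)) (ex_intro2 _ _ _ (rand_cst x) erefl).

Section DeterministicKernel.
Variables (X Y : qbs) (f : qbs_hom X Y).

Lemma delta_homP (rho : I -> X) :
  rand rho -> rand (q := qbs_P Y) ((fun x => dirac_prob (f x)) \o rho).
Proof.
move=> rr.
pose cst_hom y : qbs_rand Y :=
  @QbsHom qbs_itv Y (fun=> y) (fun _ _ => rand_cst y).
have H : forall s, rand (q := qbs_itv) s ->
    rand (q := qbs_rand Y) ((fun r => cst_hom (f (rho r))) \o s).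
  move=> s ms t [mt _]; apply: (qbs_homP f (rho := rho \o (s \o (fst \o t)))).
  by apply: rand_comp => //; exact: measurableT_comp.
by exists (@QbsHom qbs_itv (qbs_rand Y) _ H).
Qed.

Definition delta : qbs_kernel X Y := @QbsHom X (qbs_P Y) _ delta_homP.

End DeterministicKernel.

Lemma dirac_probE (X : qbs) (x : X) (U : set X) :
  qbs_measurable U -> dirac_prob x U = (\1_U x)%:E.
Proof.
move=> mU; rewrite [LHS](pushfE _ mU).
have [xU|xU] := pselect (U x).
  rewrite indicE mem_set //= -(@upsilon_setT R); congr Defs.upsilon.
  by apply/seteqP; split.
rewrite indicE memNset //=; apply: etrans (@upsilon0 R); congr Defs.upsilon.
by apply/seteqP; split.
Qed.

(* A measurable space of the library has a distinguished point, which plays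
   no role in the integral. *)
Section Integral.
Variables (X : qbs).

Definition qbs_pointed (x0 : X) : Type := X.
Variable x0 : X.

HB.instance Definition _ := gen_eqMixin (qbs_pointed x0).
HB.instance Definition _ := gen_choiceMixin (qbs_pointed x0).
HB.instance Definition _ := isPointed.Build (qbs_pointed x0) x0.

Lemma qbs_measurable0 : @qbs_measurable X set0.
Proof. by move=> alpha _; rewrite preimage_set0. Qed.

Lemma qbs_measurableC (A : set X) :
  qbs_measurable A -> qbs_measurable (~` A).
Proof.
by move=> mA alpha /mA ?; rewrite -preimage_setC; exact: measurableC.
Qed.

Lemma qbs_measurable_bigcup (A : (set X)^nat) :
  (forall i, qbs_measurable (A i)) -> qbs_measurable (\bigcup_i A i).
Proof.
move=> mA alpha ra; rewrite preimage_bigcup.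
by apply: bigcup_measurable => i _; exact: mA.
Qed.

Definition qbs_display : measure_display. Proof. by constructor. Qed.

HB.instance Definition _ := @isMeasurable.Build qbs_display (qbs_pointed x0)
  (@qbs_measurable X) qbs_measurable0 qbs_measurableC qbs_measurable_bigcup.

End Integral.

Section ProbMeasure.
Variables (X : qbs) (x0 : X) (mu : prob X).

Definition prob_measure : set (qbs_pointed x0) -> \bar R := mu.

Lemma prob_measureE : exists2 alpha : I -> X, rand alpha &
  forall U, qbs_measurable U -> prob_measure U = upsilon (alpha @^-1` U).
Proof.
have [alpha ra muE] := probP mu; exists alpha => // U mU.
by rewrite /prob_measure muE pushfE.
Qed.

Lemma prob_measure0 : prob_measure set0 = 0%E.
Proof.
have [alpha _ ->] := prob_measureE; last exact: qbs_measurable0.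
by rewrite preimage_set0 measure0.
Qed.

Lemma prob_measure_ge0 (U : set (qbs_pointed x0)) : (0 <= prob_measure U)%E.
Proof.
have [alpha _ muE] := probP mu; rewrite /prob_measure muE /pushf.
by case: pselect => // ?; exact: measure_ge0.
Qed.

Lemma prob_measure_sigma_additive : semi_sigma_additive prob_measure.
Proof.
have [alpha ra muE] := prob_measureE; move=> F mF tF mUF.
have -> : (fun n => \sum_(0 <= i < n) prob_measure (F i))%E =
          (fun n => \sum_(0 <= i < n) upsilon (alpha @^-1` F i))%E.
  by apply/funext => n; apply: eq_bigr => i _; apply: muE; exact: mF.
rewrite muE // preimage_bigcup.
apply: (@measure_semi_sigma_additive _ _ _ upsilon).
- by move=> i; exact: mF.
- move=> i j _ _ [r [Fi Fj]]; apply: tF => //; by exists (alpha r).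
- by apply: bigcup_measurable => i _; exact: mF.
Qed.

HB.instance Definition _ := isMeasure.Build _ _ _ prob_measure
  prob_measure0 prob_measure_ge0 prob_measure_sigma_additive.

Lemma prob_measure_setT : prob_measure setT = 1%E.
Proof.
have [alpha _ ->] := prob_measureE; last exact: (@measurableT _ (qbs_pointed x0)).
by rewrite preimage_setT upsilon_setT.
Qed.

HB.instance Definition _ := Measure_isProbability.Build _ _ _ prob_measure
  prob_measure_setT.

End ProbMeasure.

Definition prob_point (X : qbs) (mu : prob X) : X :=
  s2val (cid2 (probP mu)) point.

Definition qbs_integral (X : qbs) (mu : prob X) (f : X -> \bar R) : \bar R :=
  (\int[@prob_measure X (prob_point mu) mu]_x f x)%E.

(* the Kleisli composite [x |-> (U |-> \int k(y)(U) h(x)(dy))], as a family of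
   set functions *)
Definition kleisli_comp (X Y Z : qbs) (k : qbs_kernel Y Z)
    (h : qbs_kernel X Y) (x : X) (U : set Z) : \bar R :=
  if pselect (qbs_measurable U) then
    qbs_integral (h x) (fun y => (k y : prob Z) U)
  else 0%E.

Record bundle (B : qbs) := Bundle {
  bundle_tot :> qbs;
  bundle_proj : qbs_hom bundle_tot B }.

Record kernel_over (B : qbs) (E E' : bundle B) := KernelOver {
  okernel :> qbs_hom E (qbs_P E');
  okernelP : kleisli_comp (delta (bundle_proj E')) okernel =
    (fun x => delta (bundle_proj E) x : prob B) }.

(* [str] has the Dirac kernels as identities and Kleisli composition; this
   determines [str] *)
Definition is_kleisli (B : qbs) (str : category_on (@kernel_over B)) : Prop :=
  (forall E : bundle B, idm_ str E = delta (qbs_id E) :> qbs_hom E (qbs_P E)) /\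
  (forall (E E' E'' : bundle B) (k : kernel_over E' E'') (h : kernel_over E E'),
     (fun x => ccomp_ str k h x : set E'' -> \bar R) = kleisli_comp k h).

Section Fibre.
Variables (B J : qbs) (b : qbs_hom J B).

Definition fibre_tot (E : bundle B) : qbs :=
  @qbs_sub (qbs_prod J E) (fun je => b je.1 = bundle_proj E je.2).

Definition fibre_fst (E : bundle B) : qbs_hom (fibre_tot E) J :=
  @QbsHom (fibre_tot E) J (fun x => (sval x).1) (fun rho rr => proj1 rr).

Definition fibre_snd (E : bundle B) : qbs_hom (fibre_tot E) E :=
  @QbsHom (fibre_tot E) E (fun x => (sval x).2) (fun rho rr => proj2 rr).

Definition fibre (E : bundle B) : bundle J := Bundle (fibre_fst E).

Definition is_restriction (E E' : bundle B) (k : kernel_over E E')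
    (kb : kernel_over (fibre E) (fibre E')) : Prop :=
  forall x : fibre_tot E,
  exists (alpha : I -> E')
         (fib : forall r, b (fibre_fst E x) = bundle_proj E' (alpha r)),
  [/\ rand alpha,
      k (fibre_snd E x) = pushf alpha :> (set E' -> \bar R)
    & kb x = @pushf (fibre_tot E')
        (fun r => exist _ (fibre_fst E x, alpha r) (fib r))
        :> (set (fibre_tot E') -> \bar R)].

End Fibre.

Section Comparison.

Definition fibre_id_fun (B : qbs) (E : bundle B) (e : E) :
    fibre_tot (qbs_id B) E :=
  exist _ (bundle_proj E e, e) erefl.

Lemma fibre_id_homP (B : qbs) (E : bundle B) (rho : I -> E) :
  rand rho -> rand (@fibre_id_fun B E \o rho).
Proof. by move=> rr; split=> //=; exact: (qbs_homP (bundle_proj E) rr). Qed.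

Definition fibre_id (B : qbs) (E : bundle B) :
    qbs_hom E (fibre_tot (qbs_id B) E) :=
  QbsHom (@fibre_id_homP B E).

Variables (B J L : qbs) (b : qbs_hom J B) (c : qbs_hom L J) (E : bundle B).

Lemma fibre_comp_subproof (x : fibre_tot c (fibre b E)) :
  qbs_comp b c (sval x).1 = bundle_proj E (sval (sval x).2).2.
Proof. by case: x => [[l [[j e] /= je]] /= ->]. Qed.

Definition fibre_comp_fun (x : fibre_tot c (fibre b E)) :
    fibre_tot (qbs_comp b c) E :=
  exist _ ((sval x).1, (sval (sval x).2).2) (fibre_comp_subproof x).

Lemma fibre_comp_homP (rho : I -> fibre_tot c (fibre b E)) :
  rand rho -> rand (fibre_comp_fun \o rho).
Proof. by move=> [r1 [r2 r3]]; split. Qed.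

Definition fibre_comp : qbs_hom (fibre_tot c (fibre b E))
    (fibre_tot (qbs_comp b c) E) := QbsHom fibre_comp_homP.

End Comparison.

(* Fibrewise restriction needs points of the base to be distinguished by its
   sigma-algebra.  Take for [B] two points with all functions as
   random elements: its sigma-algebra is trivial, so
   [delta p' \o k = delta p] holds for every kernel [k : E ~> E']; with [E]
   one point over the first point of [B] and [E'] one point over the
   second, the identity is a kernel over [B], but its fibre over the first point
   would be a kernel from a point to the empty space.  Bases are therefore
   restricted to the spaces with a measurable diagonal (equivalently,
   [{r | alpha r = beta r}] is Borel for all random elements [alpha] and [beta]);
   total spaces are arbitrary. *)
Definition diag_measurable (B : qbs) : Prop :=
  @qbs_measurable (qbs_prod B B) [set z | z.1 = z.2].

Definition dQBS : category := @full_subcat QBS diag_measurable.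

End QuasiBorel.

(* Main.v *)
(* A kernel composite is represented by random elements thanks to two facts on
   I = [0,1], both read off binary digits: I * I is a measurable retract of I,
   which lifts a random element of P(Z) along a two-parameter family, and the
   uniform measure is carried to its square by a measurable map I -> I * I,
   which turns an iterated integral into a single pushforward.  Associativity of
   Kleisli composition is then Fubini's theorem.

   The restriction k[b] sends U over (j, e) to the mass, under k(e), of the slice
   of U over j.  To see that it is a morphism, take a family a(r, s) representing
   k along a random element: since the diagonal of the base is measurable, a
   leaves the fibre on a measurable set with null sections, on which it must be
   replaced by a point of the fibre chosen measurably in r.  Such a choice exists
   because a measurable subset of I * I contains, up to measure epsilon in every
   section at once, a measurable set with closed sections; in the latter one takes
   the lowest point of the support of the uniform measure.

   All comparison isomorphisms are deterministic, so that the coherence laws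
   reduce to equalities of functions between iterated pullbacks. *)
Require Import Defs.
From mathcomp Require Import all_boot all_order all_algebra.
From mathcomp Require Import all_classical all_reals all_analysis.
From mathcomp Require Import measurable_realfun zify lra.
Import Order.TTheory GRing.Theory Num.Theory.
Import numFieldNormedType.Exports.

Set Implicit Arguments.
Unset Strict Implicit.
Unset Printing Implicit Defensive.

Local Open Scope classical_set_scope.
Local Open Scope ring_scope.

Local Arguments unit_itv_val : simpl never.

(** * Binary digits on the unit interval and their measurability *)

Section UnitItvMeasure.
Variable R : realType.
Local Notation I := (unit_itv R).
Local Notation upsilon := (@upsilon R).
Local Notation iv := (@unit_itv_val R).

Lemma unit_itv_ge0 (x : I) : 0 <= iv x.
Proof. by have /andP[] := svalP x. Qed.

Lemma unit_itv_le1 (x : I) : iv x <= 1.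
Proof. by have /andP[] := svalP x. Qed.

Lemma measurable_unit_itv_val :
  measurable_fun setT (iv : I -> measurableTypeR R).
Proof. by move=> _ B mB; rewrite setTI; exists B. Qed.

Lemma measurable_unit_itv_preimage (B : set (measurableTypeR R)) :
  measurable B -> measurable (iv @^-1` B).
Proof. by exists B. Qed.

Lemma measurable_to_unit_itv d (T : measurableType d) (f : T -> I) :
  measurable_fun setT (iv \o f : T -> measurableTypeR R) ->
  measurable_fun setT f.
Proof.
by move=> mf _ A [B mB ->]; rewrite -comp_preimage; exact: mf.
Qed.

(** The uniform density is 1 on the unit interval, so integrating it over a subset gives Lebesgue
    measure. *)
Lemma upsilon_preimage (B : set (measurableTypeR R)) : measurable B ->
  upsilon (iv @^-1` B) = lebesgue_measure (B `&` `[0, 1]).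
Proof.
move=> mB; rewrite /Defs.upsilon.
have -> : iv @` (iv @^-1` B) = B `&` `[0, 1].
  apply/seteqP; split=> [_ [[x x01] Bx <-]|x [Bx]]; rewrite /= in_itv //=.
  by move=> x01; exists (exist _ x x01).
rewrite /uniform_prob; under eq_integral.
  move=> x; rewrite inE => -[_]; rewrite /= in_itv /= => x01.
  rewrite /uniform_pdf x01 subr0 invr1; over.
rewrite integral_cst ?mul1e//.
by apply: measurableI => //; exact: measurable_itv.
Qed.

Lemma upsilon_itv (b0 b1 : bool) (a b : R) : 0 <= a -> a <= b -> b <= 1 ->
  upsilon (iv @^-1` [set` Interval (BSide b0 a) (BSide b1 b)]) = (b - a)%:E.
Proof.
move=> a0 ab b1'; rewrite upsilon_preimage; last exact: measurable_itv.
have -> : [set` Interval (BSide b0 a) (BSide b1 b)] `&` `[0, 1]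
    = [set` Interval (BSide b0 a) (BSide b1 b)] :> set R.
  apply: setIidl => x /=; rewrite !in_itv/= => /andP[ax xb].
  rewrite (le_trans a0)/= ?(le_trans _ b1')//.
  - by case: b1 xb => // /ltW.
  - by case: b0 ax => // /ltW.
rewrite lebesgue_measure_itv/= lte_fin; case: ltP => // ba.
by rewrite (le_anti (introT andP (conj ab ba))) subrr.
Qed.

Lemma le_upsilon (A B : set I) : measurable A -> measurable B -> A `<=` B ->
  (upsilon A <= upsilon B)%E.
Proof. by move=> mA mB AB; apply: le_measure; rewrite ?inE. Qed.

(** The leading binary digit, with the tie at one half resolved to 1. *)
Definition half_bit (x : I) : bool := 2^-1 <= iv x.

Lemma doubling_subproof (x : I) : 0 <= 2 * iv x - (half_bit x)%:R <= 1.
Proof.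
have := unit_itv_ge0 x; have := unit_itv_le1 x; rewrite /half_bit.
by case: (leP 2^-1 (iv x)) => /= *; apply/andP; split; lra.
Qed.

(** Doubling modulo 1, except that 1 is a fixed point; it shifts the binary digits. *)
Definition doubling (x : I) : I :=
  exist (fun y : R => 0 <= y <= 1) _ (doubling_subproof x).

Lemma doublingE (x : I) : iv (doubling x) = 2 * iv x - (half_bit x)%:R.
Proof. by []. Qed.

Lemma measurable_half_bit : measurable [set x | half_bit x].
Proof.
have -> : [set x | half_bit x] = iv @^-1` `[2^-1, +oo[.
  by apply/seteqP; split=> x /=; rewrite in_itv /= andbT.
by apply: measurable_unit_itv_preimage; exact: measurable_itv.
Qed.

Lemma measurable_doubling : measurable_fun setT doubling.
Proof.
apply: measurable_to_unit_itv.
rewrite (_ : _ \o _ = fun x => 2 * iv x - \1_[set x | half_bit x] x); last first.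
  apply/funext => x; rewrite indicE.
  transitivity (2 * iv x - (half_bit x)%:R) => //; congr (_ - _%:R).
  by congr nat_of_bool; apply/idP/idP; rewrite inE.
apply: measurable_funB; last exact: measurable_indic measurable_half_bit.
by apply: measurable_funM => //; exact: measurable_unit_itv_val.
Qed.

Definition bits (x : I) (n : nat) : bool := half_bit (iter n doubling x).

Lemma bits_doubling (x : I) n : bits (doubling x) n = bits x n.+1.
Proof. by rewrite /bits iterSr. Qed.

Lemma measurable_bits n (b : bool) : measurable [set x | bits x n = b].
Proof.
have mi : measurable_fun setT (iter n doubling).
  elim: n => [|n IH] /=; first exact: measurable_id.
  exact: measurableT_comp measurable_doubling IH.
have -> : [set x | bits x n = b] =
    if b then iter n doubling @^-1` [set x | half_bit x]
    else ~` (iter n doubling @^-1` [set x | half_bit x]).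
  by rewrite /bits; apply/seteqP; split=> x; case: b => /=;
    case: half_bit => //=; move/(_ erefl).
have mh : measurable (iter n doubling @^-1` [set x | half_bit x]).
  by rewrite -[X in measurable X]setTI; apply: mi => //; exact: measurable_half_bit.
by case: b => //; exact: measurableC.
Qed.

Definition bsum (c : nat -> bool) n : R := \sum_(i < n) (c i)%:R / 2 ^+ i.+1.

(** Peels off the leading digit instead of the last one, to match induction along [doubling]. *)
Lemma bsumS c n : bsum c n.+1 = ((c 0%N)%:R + bsum (fun i => c i.+1) n) / 2.
Proof.
rewrite /bsum big_ord_recl /= expr1 mulrDl; congr (_ + _).
by rewrite mulr_suml; apply: eq_bigr => i _; rewrite exprSr invfM mulrA.
Qed.

Lemma bsum_ge0 c n : 0 <= bsum c n.
Proof. by apply: sumr_ge0 => i _; rewrite divr_ge0 ?exprn_ge0. Qed.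

Lemma bsum_le c n : bsum c n <= 1 - 2^-n.
Proof.
elim: n c => [|n IH] c; first by rewrite /bsum big_ord0 expr0 invr1 subrr.
rewrite bsumS exprSr invfM.
have := IH (fun i => c i.+1); case: (c 0%N) => /=; lra.
Qed.

Lemma bsum_le1 c n : bsum c n <= 1.
Proof.
apply: le_trans (bsum_le c n) _; rewrite gerBl invr_ge0 exprn_ge0//.
Qed.

Lemma bsum_has_sup c : has_sup (range (bsum c)).
Proof.
split; first by exists (bsum c 0), 0%N.
by exists 1 => _ [n _ <-]; exact: bsum_le1.
Qed.

Lemma bval_subproof c : 0 <= sup (range (bsum c)) <= 1.
Proof.
apply/andP; split.
  apply: le_trans (bsum_ge0 c 0) _; apply: sup_upper_bound; last by exists 0%N.
  exact: bsum_has_sup.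
apply: ge_sup; first by exists (bsum c 0), 0%N.
by move=> _ [n _ <-]; exact: bsum_le1.
Qed.

(** Taken as a supremum rather than a limit, so that bounds and measurability are read off the
    partial sums. *)
Definition bval c : I :=
  exist (fun y : R => 0 <= y <= 1) _ (bval_subproof c).

Lemma bsum_le_bval c n : bsum c n <= iv (bval c).
Proof. by apply: sup_upper_bound; [exact: bsum_has_sup|exists n]. Qed.

Lemma bval_le_ub c (x : R) : (forall n, bsum c n <= x) -> iv (bval c) <= x.
Proof.
move=> cx; apply: ge_sup; first by exists (bsum c 0), 0%N.
by move=> _ [n _ <-].
Qed.

Lemma bvalS c : iv (bval c) = ((c 0%N)%:R + iv (bval (fun i => c i.+1))) / 2.
Proof.
apply/eqP; rewrite eq_le; apply/andP; split.
  apply: bval_le_ub => -[|n].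
    rewrite /bsum big_ord0; have := unit_itv_ge0 (bval (fun i => c i.+1)).
    by case: (c 0%N) => /=; lra.
  by rewrite bsumS; have := bsum_le_bval (fun i => c i.+1) n; lra.
suff : iv (bval (fun i => c i.+1)) <= 2 * iv (bval c) - (c 0%N)%:R by lra.
apply: bval_le_ub => n.
by have := bsum_le_bval c n.+1; rewrite bsumS; lra.
Qed.

(** Each induction step is [doublingE] solved for [x], so the remainder after [n] digits is
    exact. *)
Lemma bsum_bits x n : iv x = bsum (bits x) n + iv (iter n doubling x) / 2 ^+ n.
Proof.
elim: n x => [|n IH] x; first by rewrite /bsum big_ord0 add0r expr0 invr1 mulr1.
rewrite bsumS iterSr (_ : (fun i => bits x i.+1) = bits (doubling x)); last first.
  by apply/funext => i; rewrite bits_doubling.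
rewrite exprSr invfM mulrA -mulrDl -addrA -IH doublingE /bits /=.
by rewrite addrC subrK mulrC mulKf ?pnatr_eq0.
Qed.

Lemma exists_exp2_lt (e : R) : 0 < e -> exists n, 2^-n < e :> R.
Proof.
move=> e0; have := @upper_nthrootP _ e^-1 _ (leqnn _).
set n := Num.Def.archi_bound _ => en; exists n.
by rewrite invf_plt ?posrE ?exprn_gt0.
Qed.

(** The remainder in [bsum_bits] lies between 0 and [2^-n], so [x] is the supremum of the partial
    sums. *)
Lemma bval_bits x : bval (bits x) = x.
Proof.
apply: unit_itv_val_inj; apply/eqP; rewrite eq_le; apply/andP; split.
  apply: bval_le_ub => n; rewrite [leRHS](bsum_bits x n) lerDl.
  by rewrite divr_ge0 ?exprn_ge0 ?unit_itv_ge0.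
rewrite leNgt; apply/negP => lt; rewrite -subr_gt0 in lt.
have [n] := exists_exp2_lt lt; rewrite ltNge => /negP; apply.
have := bsum_le_bval (bits x) n; have := bsum_bits x n.
have : iv (iter n doubling x) / 2 ^+ n <= 2^-n.
  by rewrite ler_piMl ?invr_ge0 ?exprn_ge0 ?unit_itv_le1.
lra.
Qed.

(** A zero digit leaves a gap below 1. Applied to the tail of a sequence with leading digit 0, it
    keeps the value strictly below one half. *)
Lemma bval_lt1 c m : c m = false -> iv (bval c) < 1.
Proof.
elim: m c => [|m IH] c cm; rewrite bvalS.
  by rewrite cm; have := unit_itv_le1 (bval (fun i => c i.+1)); rewrite /=; lra.
by have := IH (fun i => c i.+1) cm; case: (c 0%N) => /=; lra.
Qed.

(* [bits] computes the expansion not ending in ones (except at 1). *)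
Lemma bits_bval c : (forall n, exists m, c (n + m)%N = false) ->
  bits (bval c) = c.
Proof.
have step d : (forall n, exists m, d (n + m)%N = false) ->
    half_bit (bval d) = d 0%N /\ doubling (bval d) = bval (fun i => d i.+1).
  move=> dz.
  have h : half_bit (bval d) = d 0%N.
    rewrite /half_bit bvalS; case: (d 0%N).
      have := unit_itv_ge0 (bval (fun i => d i.+1)) => ?; apply/idP => /=; lra.
    have [m /(@bval_lt1 (fun i => d i.+1)) lt] := dz 1%N; apply/negbTE.
    by rewrite -ltNge /=; lra.
  split=> //; apply: unit_itv_val_inj; rewrite doublingE h bvalS; lra.
move=> cz; apply/funext => n; elim: n c cz => [|n IH] c cz.
  by have [] := step c cz.
have [_ cE] := step c cz; rewrite -bits_doubling cE IH// => k.
by have [m] := cz k.+1; exists m.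
Qed.

Fixpoint cyl (w : seq bool) : set (nat -> bool) :=
  if w is b :: w' then [set c | c 0%N = b /\ cyl w' (fun i => c i.+1)]
  else setT.

(** The empty set is added to make the family stable under intersection, as uniqueness of measures
    on the generated sigma-algebra requires. *)
Definition cylinders : set (set (nat -> bool)) :=
  [set A | A = set0 \/ exists w, A = cyl w].

(** Either one word is a prefix of the other, or they differ at some position and no sequence
    extends both. *)
Lemma cylI w w' :
  [\/ cyl w `&` cyl w' = set0, cyl w `&` cyl w' = cyl w
    | cyl w `&` cyl w' = cyl w'].
Proof.
elim: w w' => [|b w IH] [|b' w'] /=.
- by rewrite setIT; apply: Or32.
- by rewrite setTI; apply: Or33.
- by rewrite setIT; apply: Or32.
have [<-|bb'] := eqVneq b b'; last first.
  apply: Or31; apply/seteqP; split=> // c [[cb _] [cb' _]].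
  by move: bb'; rewrite -cb -cb' eqxx.
have E : [set c | c 0%N = b /\ cyl w (fun i => c i.+1)] `&`
   [set c | c 0%N = b /\ cyl w' (fun i => c i.+1)] =
   [set c | c 0%N = b /\ (cyl w `&` cyl w') (fun i => c i.+1)].
  by apply/seteqP; split=> c /=; tauto.
rewrite E; case: (IH w') => ->; [apply: Or31|apply: Or32|apply: Or33] => //.
by apply/seteqP; split=> c // [].
Qed.

Lemma setI_closed_cylinders : setI_closed cylinders.
Proof.
move=> A B [->|[w ->]]; first by left; rewrite set0I.
move=> [->|[w' ->]]; first by left; rewrite setI0.
by case: (cylI w w') => ->; [left|right; exists w|right; exists w'].
Qed.

Local Notation CT := (g_sigma_algebraType cylinders).

Lemma measurable_cyl w : measurable (cyl w : set CT).
Proof. by apply: sub_sigma_algebra; right; exists w. Qed.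

Lemma measurable_to_cantor d (T : measurableType d) (f : T -> CT) :
  (forall n b, measurable [set x | f x n = b]) -> measurable_fun setT f.
Proof.
move=> mf; apply: (measurability (cylinders : set (set CT))) => //.
move=> _ [_ [->|[w ->]] <-].
  by rewrite preimage_set0 setI0.
rewrite setTI; elim: w f mf => [|b w IH] f mf; first by rewrite preimage_setT.
have -> : f @^-1` cyl (b :: w) =
  [set x | f x 0%N = b] `&` ((fun x i => f x i.+1) @^-1` cyl w) by [].
by apply: measurableI => //; apply: IH => n; exact: mf.
Qed.

Lemma measurable_fun_bits : measurable_fun setT (bits : I -> CT).
Proof. by apply: measurable_to_cantor => n b; exact: measurable_bits. Qed.

Lemma measurable_shift : measurable_fun setT (fun c : CT => (fun i => c i.+1) : CT).
Proof.
apply: (measurability (cylinders : set (set CT))) => // _ [_ [->|[w ->]] <-].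
  by rewrite preimage_set0 setI0.
rewrite setTI (_ : _ @^-1` _ = cyl (true :: w) `|` cyl (false :: w)).
  by apply: measurableU; exact: measurable_cyl.
apply/seteqP; split=> c /=; last by case=> [] [].
by case: (c 0%N); [left|right].
Qed.

Lemma measurable_coord n b : measurable ([set c | c n = b] : set CT).
Proof.
elim: n => [|n IH].
  by have := measurable_cyl [:: b]; congr measurable; apply/seteqP; split=> c /=;
    tauto.
by have := measurable_shift (measurableT) IH; rewrite setTI.
Qed.

Lemma measurable_bsum n :
  measurable_fun setT (fun c : CT => bsum c n : measurableTypeR R).
Proof.
rewrite /bsum; apply: measurable_sum => i.
apply: measurable_funM => //.
rewrite (_ : (fun _ => _) = \1_([set c : CT | c i = true])); last first.
  apply/funext => c; rewrite indicE; congr (_%:R); congr nat_of_bool.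
  by apply/idP/idP; rewrite inE.
by apply: measurable_indic; exact: measurable_coord.
Qed.

(** The rays []a, +oo[] generate the Borel sets, and a supremum exceeds [a] exactly when some
    partial sum does. *)
Lemma measurable_bval : measurable_fun setT (bval : CT -> I).
Proof.
apply: measurable_to_unit_itv; apply: (measurability (@RGenOInfty.G R)).
  exact: RGenOInfty.measurableE.
move=> _ [_ [a ->] <-]; rewrite setTI.
rewrite (_ : _ @^-1` _ = \bigcup_n [set c | a < bsum c n]); last first.
  apply/seteqP; split=> c /=; rewrite in_itv /= andbT.
    move=> /(sup_gt (bsum_has_sup c).1)[_ [n _ <-] an]; by exists n.
  by move=> [n _ /= /lt_le_trans]; apply; exact: bsum_le_bval.
apply: bigcup_measurable => n _.
have := @measurable_bsum n measurableT _ (measurable_itv `]a, +oo[).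
by rewrite setTI; congr measurable; apply/seteqP; split=> c /=;
  rewrite in_itv/= andbT.
Qed.

End UnitItvMeasure.

(** The measurability proof is an explicit argument, so that the pushforward can be passed as a
    measure to lemmas about measures. *)
Definition mpushforward d d' (T1 : measurableType d) (T2 : measurableType d')
    (R : realType) (m : {measure set T1 -> \bar R}) (f : T1 -> T2)
    (mf : measurable_fun setT f) : {measure set T2 -> \bar R} :=
  measure_function_pushforward__canonical__measure_function_Measure m mf.

(** * Independence of even and odd digits; splitting and packing points of the interval *)

Section CoinTossing.
Variable R : realType.
Local Notation I := (unit_itv R).
Local Notation upsilon := (@upsilon R).
Local Notation iv := (@unit_itv_val R).
Local Notation bits := (@bits R).
Local Notation bval := (@bval R).
Local Notation CT := (g_sigma_algebraType cylinders).

(** Which endpoints of the dyadic interval belong to the cylinder depends on [w]; bracketing between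
    the open and the closed interval avoids deciding this, and both have the same measure. *)
Lemma cyl_bits_itv w : exists v : R, [/\ 0 <= v, v + 2^-(size w) <= 1,
  forall x : I, v < iv x < v + 2^-(size w) -> cyl w (bits x) &
  forall x : I, cyl w (bits x) -> v <= iv x <= v + 2^-(size w)].
Proof.
elim: w => [|b w [v [v0 v1 vw wv]]] /=.
  exists 0; rewrite expr0 invr1 add0r; split=> // x _.
  by rewrite unit_itv_ge0 unit_itv_le1.
(* Prepending [b] contracts the interval by the inverse branch of [doubling] with digit [b]. *)
exists ((b%:R + v) / 2); rewrite exprSr invfM.
have p0 : 0 < 2^-(size w) :> R by rewrite invr_gt0 exprn_gt0.
have shiftE (x : I) : (fun i => bits x i.+1) = bits (doubling x).
  by apply/funext => i; rewrite bits_doubling.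
set p := 2^-(size w) in v1 vw wv p0 *.
split=> [||x /andP[x1 x2]|x].
- by case: b => /=; lra.
- by case: b => /=; lra.
- have hb : half_bit x = b.
    rewrite /half_bit; case: b x1 x2 => /= x1 x2; first by apply/idP; lra.
    by apply/negbTE; rewrite -ltNge; lra.
  split=> //; rewrite shiftE; apply: vw; rewrite doublingE hb.
  by apply/andP; split; lra.
- rewrite shiftE => -[xb /wv]; rewrite doublingE; rewrite /bits /= in xb.
  by rewrite xb => /andP[? ?]; apply/andP; split; lra.
Qed.

Lemma measurable_fun_bits_preimage (A : set CT) : measurable A ->
  measurable ((bits : I -> CT) @^-1` A).
Proof.
by move=> mA; rewrite -[X in measurable X]setTI; exact: measurable_fun_bits.
Qed.

Lemma upsilon_cyl w :
  upsilon ((bits : I -> CT) @^-1` cyl w) = (2^-(size w))%:E.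
Proof.
have [v [v0 v1 vw wv]] := cyl_bits_itv w.
have p0 : 0 < 2^-(size w) :> R by rewrite invr_gt0 exprn_gt0.
have mc := measurable_fun_bits_preimage (measurable_cyl w).
have itvE b0 b1 : upsilon (iv @^-1` [set` Interval (BSide b0 v)
    (BSide b1 (v + 2^-(size w)))]) = (2^-(size w))%:E.
  rewrite (upsilon_itv b0 b1 v0 _ v1); last by rewrite lerDl ltW.
  by rewrite addrC addKr.
apply/eqP; rewrite eq_le; apply/andP; split.
  have <- : upsilon (iv @^-1` `[v, v + 2^-(size w)]) = (2^-(size w))%:E.
    exact: itvE.
  apply: le_upsilon => //.
  by apply: measurable_unit_itv_preimage; exact: measurable_itv.
have <- : upsilon (iv @^-1` `]v, v + 2^-(size w)[) = (2^-(size w))%:E.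
  exact: itvE.
apply: le_upsilon => //.
by apply: measurable_unit_itv_preimage; exact: measurable_itv.
Qed.

Definition evens (c : nat -> bool) : nat -> bool := fun i => c i.*2.
Definition odds (c : nat -> bool) : nat -> bool := fun i => c i.*2.+1.

Let E w w' := [set x : I | cyl w (evens (bits x)) /\ cyl w' (odds (bits x))].

Fixpoint interleave (w w' : seq bool) : seq bool :=
  match w, w' with
  | b :: w, b' :: w' => b :: b' :: interleave w w'
  | _, _ => [::]
  end.

Lemma cyl_interleave w w' c : size w = size w' ->
  cyl (interleave w w') c <-> cyl w (evens c) /\ cyl w' (odds c).
Proof.
elim: w w' c => [|b w IH] [|b' w'] c //= [] /IH {}IH.
have := IH (fun i => c i.+2); rewrite /evens /odds.
by tauto.
Qed.

Lemma size_interleave w w' : size w = size w' ->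
  size (interleave w w') = (size w + size w')%N.
Proof.
elim: w w' => [|b w IH] [|b' w'] //= [] /IH ->.
by rewrite addSn addnS.
Qed.

Lemma cyl_rcons w c :
  cyl w c <-> cyl (rcons w true) c \/ cyl (rcons w false) c.
Proof.
elim: w c => [|b w IH] c /=; last by have := IH (fun i => c i.+1); tauto.
by case: (c 0%N); tauto.
Qed.

Lemma cyl_rcons_disj w c :
  cyl (rcons w true) c -> cyl (rcons w false) c -> False.
Proof.
elim: w c => [|b w IH] c /=; last by have := IH (fun i => c i.+1); tauto.
by move=> [-> _] [].
Qed.

Lemma measurable_evens_bits :
  measurable_fun setT (evens \o bits : I -> CT).
Proof. by apply: measurable_to_cantor => n b; exact: measurable_bits. Qed.

Lemma measurable_odds_bits :
  measurable_fun setT (odds \o bits : I -> CT).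
Proof. by apply: measurable_to_cantor => n b; exact: measurable_bits. Qed.

Let mE w w' : measurable (E w w').
Proof.
apply: measurableI.
- by rewrite -[X in measurable X]setTI;
    apply: (measurable_evens_bits measurableT); exact: measurable_cyl.
- by rewrite -[X in measurable X]setTI;
    apply: (measurable_odds_bits measurableT); exact: measurable_cyl.
Qed.

(** For words of equal length the event is the cylinder of the interleaved word. Otherwise the
    shorter word is split into its two one-letter extensions, by induction on the difference of the
    lengths. *)
Lemma upsilon_evens_odds_cyl w w' :
  upsilon (E w w') = (2^-(size w) * 2^-(size w'))%:E.
Proof.
have eqsize u u' : size u = size u' ->
    upsilon (E u u') = (2^-(size u) * 2^-(size u'))%:E.
  move=> su; rewrite -invfM -exprD -size_interleave// -upsilon_cyl.
  congr (Defs.upsilon _); apply/seteqP; split=> x /=.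
    by move=> h; apply/cyl_interleave.
  by move=> /cyl_interleave; exact.
have stepr u u' : (forall b, upsilon (E u (rcons u' b)) =
    (2^-(size u) * 2^-(size (rcons u' b)))%:E) ->
    upsilon (E u u') = (2^-(size u) * 2^-(size u'))%:E.
  move=> h; have -> : E u u' = E u (rcons u' true) `|` E u (rcons u' false).
    apply/seteqP; split=> x; rewrite /E /=; have := cyl_rcons u' (odds (bits x));
    by tauto.
  rewrite measureU//; last first.
    apply/seteqP; split=> // x [[_ +] [_ +]]; exact: cyl_rcons_disj.
  rewrite /= !h !size_rcons -EFinD; congr (_%:E).
  rewrite -mulrDr exprSr invfM; lra.
have stepl u u' : (forall b, upsilon (E (rcons u b) u') =
    (2^-(size (rcons u b)) * 2^-(size u'))%:E) ->
    upsilon (E u u') = (2^-(size u) * 2^-(size u'))%:E.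
  move=> h; have -> : E u u' = E (rcons u true) u' `|` E (rcons u false) u'.
    apply/seteqP; split=> x; rewrite /E /=; have := cyl_rcons u (evens (bits x));
    by tauto.
  rewrite measureU//; last first.
    apply/seteqP; split=> // x [[+ _] [+ _]]; exact: cyl_rcons_disj.
  rewrite /= !h !size_rcons -EFinD; congr (_%:E).
  rewrite -mulrDl exprSr invfM; lra.
have [le|/ltnW le] := leqP (size w) (size w').
  elim: (size w' - size w)%N {-2}w (erefl (size w' - size w)%N) le
    => [|n IH] {}w ew le.
    by apply: eqsize; apply/eqP; rewrite eqn_leq le -subn_eq0 ew.
  by apply: stepl => b; apply: IH; rewrite size_rcons; lia.
elim: (size w - size w')%N {-2}w' (erefl (size w - size w')%N) le
    => [|n IH] {}w' ew le.
  by apply: eqsize; apply/eqP; rewrite eqn_leq le -subn_eq0 ew.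
by apply: stepr => b; apply: IH; rewrite size_rcons; lia.
Qed.

Lemma cantor_measure_unique (m1 m2 : {measure set CT -> \bar R}) :
  (m1 setT < +oo)%E -> (forall w, m1 (cyl w) = m2 (cyl w)) ->
  forall A, measurable A -> m1 A = m2 A.
Proof.
move=> fin eq_cyl A mA.
apply: (@measure_unique _ _ CT (cylinders : set (set CT)) (fun=> setT)) => //.
- exact: setI_closed_cylinders.
- by move=> _; right; exists [::].
- by rewrite bigcup_const.
- by move=> _ [->|[w ->]]; [rewrite !measure0|exact: eq_cyl].
Qed.



(** Extends independence from cylinders one argument at a time: with the other argument fixed, both
    sides are finite measures that agree on cylinders. *)
Lemma upsilon_evens_odds (A B : set CT) : measurable A -> measurable B ->
  upsilon [set x : I | A (evens (bits x)) /\ B (odds (bits x))] =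
  (upsilon (bits @^-1` A) * upsilon (bits @^-1` B))%E.
Proof.
have me (C : set CT) : measurable C -> measurable [set x | C (evens (bits x))].
  by move=> mC; rewrite -[X in measurable X]setTI; exact: measurable_evens_bits.
have mo (C : set CT) : measurable C -> measurable [set x | C (odds (bits x))].
  by move=> mC; rewrite -[X in measurable X]setTI; exact: measurable_odds_bits.
have le1 (C : set I) : measurable C -> (upsilon C < +oo)%E.
  move=> mC; apply: (@le_lt_trans _ _ (upsilon [set: I])).
    exact: le_upsilon.
  by rewrite upsilon_setT ltry.
(* [mscale] takes a nonnegative real factor, whereas [upsilon] takes extended real values. *)
pose c (C : set I) : {nonneg R} := NngNum (fine_ge0 (measure_ge0 upsilon C)).
have cE (C : set I) : measurable C -> (c C)%:num%:E = upsilon C.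
  by move=> mC; rewrite /= fineK// ge0_fin_numE ?le1.
have cylr w' (C : set CT) : measurable C ->
    upsilon [set x : I | C (evens (bits x)) /\ cyl w' (odds (bits x))] =
    (upsilon (bits @^-1` (cyl w' : set CT)) * upsilon (bits @^-1` C))%E.
  move=> mC; set mw := mo _ (measurable_cyl w').
  have mw' := measurable_fun_bits_preimage (measurable_cyl w').
  rewrite -[X in (X * _)%E]cE//.
  apply: (@cantor_measure_unique
    (mpushforward (mrestr upsilon mw) measurable_evens_bits)
    (mscale (c (bits @^-1` (cyl w' : set CT)))
      (mpushforward upsilon (@measurable_fun_bits R)))) => //.
  - by apply: le1; rewrite preimage_setT setTI.
  - move=> w; apply: etrans (upsilon_evens_odds_cyl w w') _.
    transitivity ((c (bits @^-1` (cyl w' : set CT)))%:num%:E *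
      upsilon (bits @^-1` (cyl w : set CT)))%E => //.
    by rewrite cE// !upsilon_cyl -EFinM mulrC.
move=> mA mB; have mA' := measurable_fun_bits_preimage mA.
rewrite -[X in (X * _)%E]cE//.
transitivity (upsilon ((odds \o bits : I -> CT) @^-1` B `&`
    [set x | A (evens (bits x))])).
  by congr (Defs.upsilon _); apply/seteqP; split=> x [].
apply: (@cantor_measure_unique
    (mpushforward (mrestr upsilon (me _ mA)) measurable_odds_bits)
    (mscale (c (bits @^-1` A)) (mpushforward upsilon (@measurable_fun_bits R)))).
- by apply: le1; rewrite preimage_setT setTI; exact: me.
- move=> w; transitivity ((c (bits @^-1` A))%:num%:E *
      upsilon (bits @^-1` (cyl w : set CT)))%E => //.
  rewrite cE// muleC; apply: etrans (cylr _ _ mA).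
  by congr (Defs.upsilon _); apply/seteqP; split=> x [].
- by [].
Qed.

(** [unzipl] and [unzipr] are used for their effect on the measure, [unpackl] and [unpackr] below as
    a retraction of [pack]. *)
Definition unzipl (x : I) : I := bval (evens (bits x)).
Definition unzipr (x : I) : I := bval (odds (bits x)).

Lemma measurable_unzipl : measurable_fun setT unzipl.
Proof. exact: measurableT_comp (@measurable_bval R) measurable_evens_bits. Qed.

Lemma measurable_unzipr : measurable_fun setT unzipr.
Proof. exact: measurableT_comp (@measurable_bval R) measurable_odds_bits. Qed.

Lemma measurable_unzip : measurable_fun setT (fun x => (unzipl x, unzipr x)).
Proof.
apply/measurable_fun_pairP.
by split; [exact: measurable_unzipl|exact: measurable_unzipr].
Qed.

(** Independence of even and odd digits is the product formula on rectangles, which determines the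
    product measure; [bval_bits] undoes the passage through digit sequences. *)
Lemma upsilon_unzip (U : set (I * I)) : measurable U ->
  (upsilon \x upsilon)%E U = upsilon [set x | U (unzipl x, unzipr x)].
Proof.
move=> mU.
apply: (@product_measure_unique _ _ _ _ _ upsilon upsilon
  (mpushforward upsilon measurable_unzip)) => // A B mA mB.
have mv (C : set I) : measurable C -> measurable (bval @^-1` C : set CT).
  by move=> mC; rewrite -[X in measurable X]setTI; exact: measurable_bval.
have bK (C : set I) : bits @^-1` (bval @^-1` C) = C.
  by apply/seteqP; split=> x /=; rewrite bval_bits.
apply: etrans (upsilon_evens_odds (mv _ mA) (mv _ mB)) _.
by rewrite !bK.
Qed.

(* Zeros are inserted between the digits of the two arguments, so that the
   expansion does not end in ones and can be recovered from its value. *)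
Definition pack_digits (xy : I * I) (n : nat) : bool :=
  if odd n then false
  else if odd n./2 then bits xy.2 n./2./2 else bits xy.1 n./2./2.

Definition pack (xy : I * I) : I := bval (pack_digits xy).
Definition unpackl (t : I) : I := bval (evens (evens (bits t))).
Definition unpackr (t : I) : I := bval (odds (evens (bits t))).

Lemma bits_pack xy : bits (pack xy) = pack_digits xy.
Proof.
(* The position [n + n.+1] is odd, and [pack_digits] has a zero at every odd position. *)
apply: bits_bval => n; exists n.+1; rewrite /pack_digits.
by rewrite oddD /= addbN addbb.
Qed.

Lemma unpacklK x y : unpackl (pack (x, y)) = x.
Proof.
rewrite /unpackl bits_pack (_ : evens _ = bits x) ?bval_bits//.
by apply/funext => n; rewrite /evens /pack_digits /= !odd_double !doubleK odd_double.
Qed.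

Lemma unpackrK x y : unpackr (pack (x, y)) = y.
Proof.
rewrite /unpackr bits_pack (_ : odds _ = bits y) ?bval_bits//.
apply/funext => n; rewrite /odds /evens /pack_digits /=.
by rewrite !odd_double !doubleK /= odd_double uphalf_double.
Qed.

Lemma measurable_pack : measurable_fun setT pack.
Proof.
apply: (measurableT_comp (@measurable_bval R)).
apply: measurable_to_cantor => n b; rewrite /pack_digits.
case: (odd n) => /=.
  case: b; first by rewrite (_ : [set _ | _] = set0)//; apply/seteqP; split.
  by rewrite (_ : [set _ | _] = setT)//; apply/seteqP; split.
case: (odd n./2).
  by have := @measurable_snd _ _ I I measurableT _ (@measurable_bits R n./2./2 b);
    rewrite setTI.
by have := @measurable_fst _ _ I I measurableT _ (@measurable_bits R n./2./2 b);
  rewrite setTI.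
Qed.

Lemma measurable_unpackl : measurable_fun setT unpackl.
Proof.
apply: (measurableT_comp (@measurable_bval R)).
by apply: measurable_to_cantor => n b; exact: measurable_bits.
Qed.

Lemma measurable_unpackr : measurable_fun setT unpackr.
Proof.
apply: (measurableT_comp (@measurable_bval R)).
by apply: measurable_to_cantor => n b; exact: measurable_bits.
Qed.

End CoinTossing.

(** * Approximation by sets with open sections, and measurable selection *)

Section Selection.
Variable R : realType.
Local Notation I := (unit_itv R).
Local Notation upsilon := (@upsilon R).
Local Notation iv := (@unit_itv_val R).

Definition open_sections (O : set (I * I)) := forall r s, O (r, s) ->
  exists2 e : R, 0 < e & forall s', `|iv s - iv s'| < e -> O (r, s').

(** Outer regularity of all sections with the same error, realised by one jointly measurable set;
    this uniformity makes the selected point depend measurably on [r]. *)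
Definition outer_approx (A : set (I * I)) := forall e : R, 0 < e ->
  exists O, [/\ measurable O, open_sections O, A `<=` O &
    forall r, (upsilon (xsection (O `\` A) r) <= e%:E)%E].

Lemma upsilon_outer_regular (B : set I) (e : R) : measurable B -> 0 < e ->
  exists V : set I, [/\ measurable V, B `<=` V, (upsilon (V `\` B) <= e%:E)%E &
    forall s, V s -> exists2 d : R, 0 < d & forall s', `|iv s - iv s'| < d -> V s'].
Proof.
move=> [C mC ->] e0.
have m01 : measurable (`[0, 1]%classic : set (measurableTypeR R)).
  exact: measurable_itv.
have mD : measurable (C `&` `[0, 1] : set (measurableTypeR R)).
  exact: measurableI.
have [|U [oU CU Ue]] := lebesgue_regularity_outer mD _ e0.
  suff : (upsilon (iv @^-1` C) < +oo)%E by rewrite upsilon_preimage.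
  apply: (@le_lt_trans _ _ (upsilon setT)).
    by apply: le_upsilon => //; exact: measurable_unit_itv_preimage.
  by rewrite upsilon_setT ltry.
have mU : measurable (U : set (measurableTypeR R)) by exact: open_measurable.
exists (iv @^-1` U); split.
- exact: measurable_unit_itv_preimage.
- move=> s Cs; apply: CU; split => //=.
  by rewrite in_itv /= unit_itv_ge0 unit_itv_le1.
- have -> : iv @^-1` U `\` iv @^-1` C = iv @^-1` (U `\` C) by [].
  have mUC : measurable (U `\` C : set (measurableTypeR R)) by exact: measurableD.
  rewrite upsilon_preimage//; apply: le_trans (ltW Ue).
  apply: le_measure; rewrite ?inE.
  + exact: measurableI.
  + exact: measurableD.
  + by move=> x [[Ux nCx] _]; split=> // -[].
- move=> s Us; have /nbhs_ballP[d /= d0 dU] := open_nbhs_nbhs (conj oU Us).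
  by exists d => // s' ss'; apply: dU.
Qed.

Lemma outer_approx_fst (A : set I) : measurable A -> outer_approx (fst @^-1` A).
Proof.
move=> mA e e0; exists (fst @^-1` A); split=> //.
- by rewrite -[X in measurable X]setTI; exact: measurable_fst.
- by move=> r s Ar; exists 1.
- by move=> r; rewrite setDv xsection0 measure0 lee_fin ltW.
Qed.

Lemma outer_approx_snd (B : set I) : measurable B -> outer_approx (snd @^-1` B).
Proof.
move=> mB e e0; have [V [mV BV Ve oV]] := upsilon_outer_regular mB e0.
exists (snd @^-1` V); split=> //.
- by rewrite -[X in measurable X]setTI; exact: measurable_snd.
- by move=> r s /= /oV.
- by move=> x /=; exact: BV.
- move=> r; rewrite (_ : xsection _ r = V `\` B)//.
  by apply/seteqP; split=> s; rewrite /xsection /= inE.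
Qed.

Lemma open_sections_bigcup (O : (set (I * I))^nat) :
  (forall n, open_sections (O n)) -> open_sections (\bigcup_n O n).
Proof.
move=> oO r s [n _ /oO[e e0 h]]; exists e => // s' /h ?; by exists n.
Qed.

Lemma open_sectionsI (O O' : set (I * I)) :
  open_sections O -> open_sections O' -> open_sections (O `&` O').
Proof.
move=> oO oO' r s [/oO[e e0 h] /oO'[e' e'0 h']].
exists (Num.min e e'); first by rewrite lt_min e0.
by move=> s'; rewrite lt_min => /andP[/h ? /h' ?].
Qed.

(** The errors [e / 2 ^ n.+1] add up to at most [e] in every section at once. *)
Lemma outer_approx_bigcup (A : (set (I * I))^nat) :
  (forall n, measurable (A n)) -> (forall n, outer_approx (A n)) ->
  outer_approx (\bigcup_n A n).
Proof.
move=> mA oA e e0.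
have e'0 n : 0 < e / (2 ^ n.+1)%:R by rewrite divr_gt0// ltr0n expn_gt0.
pose O n := projT1 (cid (oA n _ (e'0 n))).
have mO n : measurable (O n) by rewrite /O; case: cid => ? [].
have oO n : open_sections (O n) by rewrite /O; case: cid => ? [].
have AO n : A n `<=` O n by rewrite /O; case: cid => ? [].
have Oe n r : (upsilon (xsection (O n `\` A n) r) <= (e / (2 ^ n.+1)%:R)%:E)%E.
  by rewrite /O; case: cid => ? [].
exists (\bigcup_n O n); split.
- exact: bigcup_measurable.
- exact: open_sections_bigcup.
- by apply: subset_bigcup => n _; exact: AO.
- move=> r; apply: le_trans (epsilon_trick0 xpredT (ltW e0)).
  apply: le_trans (_ : _ <= \sum_(n <oo) upsilon (xsection (O n `\` A n) r))%E _.
    apply: measure_sigma_subadditive.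
    + by move=> n; apply: measurable_xsection; exact: measurableD.
    + by apply: measurable_xsection; apply: measurableD; exact: bigcup_measurable.
    + move=> s /xsectionP[[n _ Os] nA]; exists n => //; apply/xsectionP; split=> //.
      by move=> As; apply: nA; exists n.
  by apply: lee_nneseries => // n _; exact: Oe.
Qed.

(** A countable intersection need not keep open sections, so over each [r] it is truncated at a
    stage [m] where the surplus [F m] has section measure at most [e / 2]. The stage depends on [r],
    but the set [Q m] where stage [m] suffices is measurable. The other half of the error is shared
    among the [O n]. *)
Lemma outer_approx_bigcap (A : (set (I * I))^nat) :
  (forall n, measurable (A n)) -> (forall n, outer_approx (A n)) ->
  outer_approx (\bigcap_n A n).
Proof.
move=> mA oA e e0.
have e2 : 0 < e / 2 by rewrite divr_gt0.
have e'0 n : 0 < e / 2 / (2 ^ n.+1)%:R by rewrite divr_gt0// ltr0n expn_gt0.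
pose O n := projT1 (cid (oA n _ (e'0 n))).
have mO n : measurable (O n) by rewrite /O; case: cid => ? [].
have oO n : open_sections (O n) by rewrite /O; case: cid => ? [].
have AO n : A n `<=` O n by rewrite /O; case: cid => ? [].
have Oe n r : (upsilon (xsection (O n `\` A n) r) <= (e / 2 / (2 ^ n.+1)%:R)%:E)%E.
  by rewrite /O; case: cid => ? [].
pose D m := \big[setI/setT]_(n < m) O n.
pose F m := (\big[setI/setT]_(n < m) A n) `\` \bigcap_n A n.
have mF m : measurable (F m).
  apply: measurableD; last exact: bigcapT_measurable.
  by apply: bigsetI_measurable.
have mD m : measurable (D m) by apply: bigsetI_measurable.
pose Q m := [set r | (upsilon (xsection (F m) r) <= (e / 2)%:E)%E].
have mQ m : measurable (Q m).
  have := emeasurable_fun_infty_c measurableT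
    (measurable_fun_xsection upsilon (mF m)) (e / 2)%:E.
  by rewrite setTI.
(* The sets [F m] decrease to the empty set, and [upsilon] is finite, so continuity from above
   applies in each section. *)
have QT r : exists m, Q m r.
  have : (fun m => upsilon (xsection (F m) r)) @ \oo --> 0%E.
    rewrite -(measure0 upsilon) (_ : set0 = \bigcap_m xsection (F m) r).
      apply: nonincreasing_cvg_mu.
      - apply: (@le_lt_trans _ _ (upsilon setT)).
          by apply: le_upsilon => //; exact: measurable_xsection.
        by rewrite upsilon_setT ltry.
      - by move=> m; exact: measurable_xsection.
      - by apply: bigcapT_measurable => m; exact: measurable_xsection.
      - move=> m n mn; apply/subsetPset => s /xsectionP[h1 h2].
        apply/xsectionP; split=> //; move: h1; rewrite -!bigcap_mkord.
        by move=> h i /= im; apply: h => /=; exact: leq_trans mn.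
    apply/seteqP; split=> // s h.
    have /xsectionP[_] := h 0%N Logic.I; apply=> n _.
    have /xsectionP[+ _] := h n.+1 Logic.I.
    by rewrite -bigcap_mkord; apply => /=.
  have nb : nbhs (0%E : \bar R) [set x | (x < (e / 2)%:E)%E].
    by apply: open_nbhs_nbhs; split; [exact: open_ereal_lt_ereal|rewrite /= lte_fin].
  by move=> /(_ _ nb)[N _ h]; exists N; apply: ltW; exact: (h N (leqnn N)).
have Dsub m n : (m <= n)%N -> D n `<=` D m.
  by move=> mn x; rewrite /D -!bigcap_mkord => h i /= im; apply: h => /=;
    exact: leq_trans mn.
exists (\bigcup_m (fst @^-1` Q m `&` D m)); split.
- apply: bigcup_measurable => m _; apply: measurableI => //.
  by rewrite -[X in measurable X]setTI; exact: measurable_fst.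
- apply: open_sections_bigcup => m; apply: open_sectionsI.
    by move=> r s Qr; exists 1.
  rewrite /D; elim: m => [|m IH]; first by rewrite big_ord0 => r s _; exists 1.
  by rewrite big_ord_recr; exact: open_sectionsI.
- move=> [r s] As; have [m Qm] := QT r; exists m => //; split=> //.
  by rewrite /D -bigcap_mkord => n _; apply: AO; exact: As.
- move=> r.
  (* For the least [m] with [Q m r], every piece that meets the section over [r] lies in [D m],
     because the sets [D n] decrease. *)
  have [m Qm mmin] : exists2 m, Q m r & forall n, Q n r -> (m <= n)%N.
    have ex : exists m, `[< Q m r >] by have [m ?] := QT r; exists m; apply/asboolP.
    exists (ex_minn ex); first by case: ex_minnP => k /asboolP.
    by move=> n Qn; case: ex_minnP => k _; apply; apply/asboolP.
  pose G n := O n `\` A n.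
  have mG n : measurable (G n) by exact: measurableD.
  apply: (@le_trans _ _ (upsilon (xsection (F m) r `|` \bigcup_n xsection (G n) r))).
    apply: le_upsilon.
    + apply: measurable_xsection; apply: measurableD; last exact: bigcapT_measurable.
      apply: bigcup_measurable => k _; apply: measurableI => //.
      by rewrite -[X in measurable X]setTI; exact: measurable_fst.
    + apply: measurableU; first exact: measurable_xsection.
      by apply: bigcup_measurable => k _; exact: measurable_xsection.
    + move=> s /xsectionP[[k _ [/= Qk Dk]] nA].
      have {}Dk := Dsub _ _ (mmin _ Qk) _ Dk.
      have [inA|] := pselect ((\big[setI/setT]_(n < m) A n) (r, s)).
        by left; apply/xsectionP.
      move=> ninA; right; rewrite -bigcap_mkord in ninA.
      move/existsNP : ninA => [n /not_implyP[nm nAn]]; exists n => //.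
      apply/xsectionP; split=> //; move: Dk; rewrite /D -bigcap_mkord.
      by apply.
  apply: le_trans (measureU2 _ _ _) _.
  + exact: measurable_xsection.
  + by apply: bigcup_measurable => k _; exact: measurable_xsection.
  rewrite [e in X in (_ <= X)%E]splitr EFinD; apply: leeD => //.
  apply: le_trans (epsilon_trick0 xpredT (ltW e2)).
  apply: le_trans (_ : _ <= \sum_(n <oo) upsilon (xsection (G n) r))%E _.
    apply: measure_sigma_subadditive => //.
    + by move=> n; exact: measurable_xsection.
    + by apply: bigcup_measurable => k _; exact: measurable_xsection.
  by apply: lee_nneseries => // n _; exact: Oe.
Qed.

(** The approximation is asked of a set and of its complement, so that complementation is built in.
    Unions and intersections then exchange roles, and the class is a sigma-algebra containing the
    cylinders over both factors. *)
Lemma measurable_outer_approx (A : set (I * I)) : measurable A -> outer_approx A.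
Proof.
suff : measurable `<=` [set B : set (I * I) |
    [/\ measurable B, outer_approx B & outer_approx (~` B)]].
  by move=> h /h[].
apply: smallest_sub.
  split=> /=.
  - split; first exact: measurable0.
    + by rewrite -(preimage_set0 fst); exact: outer_approx_fst.
    + by rewrite setC0 -(preimage_setT fst); exact: outer_approx_fst.
  - move=> B [mB oB oCB]; rewrite setTD; split=> //; first exact: measurableC.
    by rewrite setCK.
  - move=> B hB.
    have mB n : measurable (B n) by have [] := hB n.
    split.
    + exact: bigcup_measurable.
    + by apply: outer_approx_bigcup => // n; have [] := hB n.
    + rewrite setC_bigcup; apply: outer_approx_bigcap => n.
        exact: measurableC.
      by have [] := hB n.
move=> B [[C mC <-]|[C mC <-]]; rewrite setTI; split.
- by rewrite -[X in measurable X]setTI; exact: measurable_fst.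
- exact: outer_approx_fst.
- by rewrite preimage_setC; apply: outer_approx_fst; exact: measurableC.
- by rewrite -[X in measurable X]setTI; exact: measurable_snd.
- exact: outer_approx_snd.
- by rewrite preimage_setC; apply: outer_approx_snd; exact: measurableC.
Qed.

(* If [K] has closed sections of positive measure, the infimum of the support of
   [upsilon] restricted to the section over [r] belongs to that section and
   depends measurably on [r]. *)
Lemma measurable_selection (M : set (I * I)) : measurable M ->
  (forall r, upsilon (xsection M r) = 1%E) ->
  exists2 sel : I -> I, measurable_fun setT sel & forall r, M (r, sel r).
Proof.
move=> mM M1.
(* The complement of [M] is approximated with error one half: the complement of [O] is contained in
   [M], has closed sections, and each section keeps measure at least one half. *)
have [|O [mO oO CO O2]] := measurable_outer_approx (measurableC mM) (_ : 0 < 2^-1).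
  by rewrite invr_gt0.
pose K r a := xsection (~` O) r `&` iv @^-1` `]-oo, a[.
have mray a : measurable (iv @^-1` `]-oo, a[).
  by apply: measurable_unit_itv_preimage; exact: measurable_itv.
have mK r a : measurable (K r a).
  by apply: measurableI => //; apply: measurable_xsection; exact: measurableC.
have subK r a b : a <= b -> K r a `<=` K r b.
  move=> ab s [? h]; split=> //; move: h.
  by rewrite /= !in_itv /= => /lt_le_trans; apply.
(* For [a > 1] the set [K r a] is the whole section of the complement of [O], which is not null. *)
have K0 r a : upsilon (K r a) = 0%E -> a <= 1.
  move=> Ka; rewrite leNgt; apply/negP => a1.
  have : (1 <= 2^-1%:E :> \bar R)%E.
    rewrite -(M1 r); apply: le_trans (O2 r).
    rewrite -[leRHS]add0e -Ka; apply: le_trans (measureU2 _ _ _) => //.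
    + apply: le_upsilon.
      * exact: measurable_xsection.
      * apply: measurableU => //; apply: measurable_xsection.
        by apply: measurableD => //; exact: measurableC.
      * move=> s /xsectionP Ms; have [Os|nOs] := pselect (O (r, s)).
          by right; apply/xsectionP; split=> //; apply.
        left; split; first exact/xsectionP.
        by rewrite /= in_itv /= (le_lt_trans (unit_itv_le1 s)).
    + apply: measurable_xsection; apply: measurableD => //; exact: measurableC.
  by rewrite lee_fin leNgt invf_lt1 ?ltr1n.
pose Z r := [set a | upsilon (K r a) = 0%E].
have Z0 r : Z r 0.
  rewrite /Z /= (_ : K r 0 = set0) ?measure0//; apply/seteqP; split=> // s [_].
  by rewrite /= in_itv /= ltNge unit_itv_ge0.
have supZ r : has_sup (Z r).
  by split; [exists 0; exact: Z0|exists 1 => a; exact: K0].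
have Zdown r a b : a <= b -> Z r b -> Z r a.
  move=> ab; rewrite /Z /= => Zb; apply/eqP; rewrite -measure_le0 -Zb.
  by apply: le_upsilon => //; exact: subK.
have sup01 r : 0 <= sup (Z r) <= 1.
  apply/andP; split; first by apply: sup_upper_bound.
  by apply: ge_sup => [|a]; [exists 0; exact: Z0|exact: K0].
pose sel r : I := exist (fun y : R => 0 <= y <= 1) _ (sup01 r).
exists sel => [|r].
  apply: measurable_to_unit_itv; apply: (measurability (@RGenOInfty.G R)).
    exact: RGenOInfty.measurableE.
  move=> _ [_ [a ->] <-]; rewrite setTI.
  (* As [Z r] is closed downwards, its supremum exceeds [a] exactly when it contains a rational
     above [a]; for a fixed rational, nullity of the section is measurable in [r]. *)
  have -> : (iv \o sel) @^-1` `]a, +oo[ = \bigcup_(q : rat)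
      [set r | a < ratr q /\ Z r (ratr q)].
    apply/seteqP; split=> r /=; rewrite in_itv /= andbT.
      move=> /(sup_gt (supZ r).1)[b Zb ab].
      have [q] := rat_in_itvoo ab; rewrite in_itv /= => /andP[aq qb].
      by exists q => //; split=> //; apply: Zdown Zb; exact: ltW.
    move=> [q _ [aq Zq]]; apply: lt_le_trans aq _.
    by apply: sup_upper_bound.
  apply: bigcupT_measurable_rat => q.
  have [aq|aq] := boolP (a < ratr q); last first.
    by rewrite (_ : [set _ | _] = set0)//; apply/seteqP; split=> // r [].
  have mC : measurable ((~` O) `&` (snd @^-1` (iv @^-1` `]-oo, (ratr q)[))).
    apply: measurableI; first exact: measurableC.
    by rewrite -[X in measurable X]setTI; exact: measurable_snd.
  have := measurable_fun_xsection upsilon mC measurableT (emeasurable_set1 0%E).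
  rewrite setTI; congr (measurable _); apply/seteqP; split=> r /=.
    move=> h; split=> //; rewrite /Z /= -h; congr (upsilon _).
    by apply/seteqP; split=> s; rewrite /K /xsection /= !inE.
  move=> [_ h]; rewrite -h; congr (upsilon _).
  by apply/seteqP; split=> s; rewrite /K /xsection /= !inE.
(* If [sel r] were outside [M], a ball of radius [e] around it would lie in the section of [O]. Then
   [K r (sup (Z r) + e)] adds nothing to the null set [K r z], contradicting the supremum. *)
apply: contrapT => /CO /oO [e e0 he].
have [z Zz ze] := sup_adherent e0 (supZ r).
have : Z r (sup (Z r) + e).
  apply/eqP; rewrite -measure_le0 -[leRHS]Zz; apply: le_upsilon => //.
  move=> s [/xsectionP nO]; rewrite /= in_itv /= => se; split; first exact/xsectionP.
  rewrite /= in_itv /= ltNge; apply/negP => zs; apply: nO; apply: he.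
  have selE : iv (sel r) = sup (Z r) by [].
  by rewrite ltr_distl selE; apply/andP; split; lra.
move=> /(sup_upper_bound (supZ r)).
by rewrite gerDl leNgt e0.
Qed.

End Selection.

(** * The Kleisli category of the probability monad and kernels over a base *)

Section Kleisli.
Variable R : realType.
Local Notation I := (unit_itv R).
Local Notation upsilon := (@upsilon R).
Implicit Types X Y Z : qbs R.

(* Equivalently, [a] is a morphism [I * I -> X]. *)
Definition joint X (a : I -> I -> X) : Prop := forall s1 s2 : I -> I,
  measurable_fun setT s1 -> measurable_fun setT s2 ->
  rand (fun r => a (s1 r) (s2 r)).

Lemma joint_unpack X (a : I -> I -> X) : joint a ->
  rand (fun t => a (unpackl t) (unpackr t)).
Proof. by apply; [exact: measurable_unpackl|exact: measurable_unpackr]. Qed.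

Lemma joint_rand X (a : I -> I -> X) r : joint a -> rand (a r).
Proof. by apply; [exact: measurable_cst|exact: measurable_id]. Qed.

Lemma joint_hom X Y (f : qbs_hom X Y) (a : I -> I -> X) : joint a ->
  joint (fun r s => f (a r s)).
Proof. by move=> ja s1 s2 m1 m2; exact: (qbs_homP f (ja _ _ m1 m2)). Qed.

(** Currying: a morphism from [I] to the function space is a jointly random two-parameter family. *)
Lemma rand_qbs_P X (beta : I -> qbs_P X) : rand beta <->
  exists2 a : I -> I -> X, joint a &
    forall r, (beta r : prob X) = pushf (a r) :> (set X -> \bar R).
Proof.
split=> [[alpha betaE]|[a ja betaE]].
  exists (fun r s => alpha r s) => // s1 s2 m1 m2.
  exact: (qbs_homP alpha (rho := id) (@measurable_id _ _ _) (fun r => (s1 r, s2 r))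
    (conj m1 m2)).
pose h r : qbs_rand X := @QbsHom R (@qbs_itv R) X (a r)
  (fun f mf => rand_comp mf (joint_rand r ja)).
have hP f : rand (q := @qbs_itv R) f -> rand (q := qbs_rand X) (h \o f).
  by move=> mf s [m1 m2]; apply: (ja (f \o (fst \o s))) => //;
    exact: measurableT_comp.
by exists (QbsHom hP).
Qed.

(** [qbs_measurable] only tests random elements indexed by [I]. Unpacking makes the family such an
    element, and pulling back along [pack] returns to [I * I]. *)
Lemma measurable_joint X (a : I -> I -> X) (U : set X) : joint a ->
  qbs_measurable U -> measurable [set z : I * I | U (a z.1 z.2)].
Proof.
move=> /joint_unpack ra /(_ _ ra) mU.
have := measurable_pack measurableT mU; rewrite setTI; congr (measurable _).
by apply/seteqP; split=> -[x y] /=; rewrite unpacklK unpackrK.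
Qed.

Lemma prob_notin X (mu : prob X) (U : set X) : ~ qbs_measurable U -> mu U = 0%E.
Proof. by move=> nU; have [a _ ->] := probP mu; rewrite /pushf; case: pselect. Qed.

Lemma prob_ext X (mu nu : prob X) :
  (forall U, qbs_measurable U -> mu U = nu U) -> mu = nu.
Proof.
move=> h; apply: prob_eq; apply/funext => U.
by have [mU|nU] := pselect (qbs_measurable U); [exact: h|rewrite !prob_notin].
Qed.

Lemma prob_ge0 X (mu : prob X) (U : set X) : (0 <= mu U)%E.
Proof.
by have [a _ ->] := probP mu; rewrite /pushf; case: pselect => // ?; exact: measure_ge0.
Qed.

(** Along [pack] the kernel is represented by a joint family [b], and its value on [U] is then the
    measure of a section of a measurable set. *)
Lemma measurable_kernel_joint X Y (k : qbs_kernel X Y) (a : I -> I -> X)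
    (U : set Y) : joint a -> qbs_measurable U ->
  measurable_fun setT (fun z : I * I => (k (a z.1 z.2) : prob Y) U).
Proof.
move=> ja mU.
have /rand_qbs_P[b jb kb] := qbs_homP k (joint_unpack ja).
rewrite (_ : (fun _ => _) =
  (fun r => upsilon (xsection [set z : I * I | U (b z.1 z.2)] r)) \o @pack R).
  exact: measurableT_comp
    (measurable_fun_xsection upsilon (measurable_joint jb mU)) (@measurable_pack R).
apply/funext => -[r s]; have := kb (pack (r, s)).
rewrite /= unpacklK unpackrK => ->; rewrite pushfE//; congr (Defs.upsilon _).
by apply/seteqP; split=> t; rewrite /xsection /= inE.
Qed.

Lemma measurable_kernel X Y (k : qbs_kernel X Y) (alpha : I -> X) (U : set Y) :
  rand alpha -> qbs_measurable U ->
  measurable_fun setT (fun r => (k (alpha r) : prob Y) U).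
Proof.
move=> ra mU.
have ja : joint (fun r _ => alpha r).
  by move=> s1 s2 m1 _; exact: (rand_comp m1 ra).
exact: (measurableT_comp (measurable_kernel_joint k ja mU) (pair2_measurable point)).
Qed.

(** Change of variables. Measurability along all random elements is exactly measurability for the
    sigma-algebra of [X]. *)
Lemma qbs_integralE X (mu : prob X) (alpha : I -> X) (f : X -> \bar R) :
  rand alpha -> mu = pushf alpha :> (set X -> \bar R) ->
  (forall beta : I -> X, rand beta -> measurable_fun setT (f \o beta)) ->
  (forall x, 0 <= f x)%E ->
  qbs_integral mu f = (\int[upsilon]_r f (alpha r))%E.
Proof.
move=> ra muE mf f0; rewrite /qbs_integral.
set x0 := prob_point mu.
have ma : measurable_fun setT (alpha : I -> qbs_pointed x0).
  by move=> _ A mA; rewrite setTI; exact: mA.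
have mf' : measurable_fun setT (f : qbs_pointed x0 -> \bar R).
  move=> _ A mA; rewrite setTI.
  suff : qbs_measurable (f @^-1` A) by [].
  by move=> beta rb; have := mf _ rb measurableT _ mA; rewrite setTI.
rewrite (eq_measure_integral (mpushforward upsilon ma)); last first.
  move=> A mA _; transitivity (mu A) => //.
  by rewrite muE pushfE.
by rewrite (ge0_integral_pushforward ma).
Qed.

Lemma kleisli_compE X Y Z (k : qbs_kernel Y Z) (h : qbs_kernel X Y) (x : X)
    (alpha : I -> Y) (U : set Z) :
  rand alpha -> (h x : prob Y) = pushf alpha :> (set Y -> \bar R) ->
  qbs_measurable U ->
  kleisli_comp k h x U = (\int[upsilon]_r (k (alpha r) : prob Z) U)%E.
Proof.
move=> ra hE mU; rewrite /kleisli_comp; case: pselect => //= ?.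
apply: qbs_integralE => // [beta rb|y]; last exact: prob_ge0.
exact: measurable_kernel.
Qed.

(** The iterated integral is the product measure of a subset of [I * I], and [upsilon_unzip] turns
    it into a single pushforward. *)
Lemma kleisli_comp_pushf X Y Z (k : qbs_kernel Y Z) (h : qbs_kernel X Y) (x : X)
    (alpha : I -> Y) (a : I -> I -> Z) :
  rand alpha -> (h x : prob Y) = pushf alpha :> (set Y -> \bar R) -> joint a ->
  (forall s, (k (alpha s) : prob Z) = pushf (a s) :> (set Z -> \bar R)) ->
  kleisli_comp k h x = pushf (fun t => a (unzipl t) (unzipr t)).
Proof.
move=> ra hE ja kE; apply/funext => U.
have [mU|nU] := pselect (qbs_measurable U); last first.
  by rewrite /kleisli_comp /pushf; case: pselect.
rewrite (kleisli_compE _ ra hE mU) pushfE//.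
under eq_integral do rewrite kE pushfE//.
have mW := measurable_joint ja mU.
rewrite -[RHS](upsilon_unzip mW); apply: eq_integral => s _.
by congr (Defs.upsilon _); apply/seteqP; split=> t; rewrite /xsection /= inE.
Qed.

Section Composition.
Variables (X Y Z : qbs R) (k : qbs_kernel Y Z) (h : qbs_kernel X Y).

Lemma kleisli_subproof (x : X) :
  exists2 alpha, rand alpha & kleisli_comp k h x = pushf alpha.
Proof.
have [alpha ra hE] := probP (h x : prob Y).
have /rand_qbs_P[a ja kE] := qbs_homP k ra.
exists (fun t => a (unzipl t) (unzipr t)).
  by apply: ja; [exact: measurable_unzipl|exact: measurable_unzipr].
exact: (kleisli_comp_pushf ra hE).
Qed.

Definition kleisli_fun (x : X) : prob Z := Prob (kleisli_subproof x).

Lemma kleisli_homP (rho : I -> X) :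
  rand rho -> rand (q := qbs_P Z) (kleisli_fun \o rho).
Proof.
move=> rr; have /rand_qbs_P[b jb hE] := qbs_homP h rr.
have rb := joint_unpack jb.
have /rand_qbs_P[a ja kE] := qbs_homP k rb.
apply/rand_qbs_P.
(* [a] represents [k] along the unpacked family [b], so [a (pack (r, s))] represents [k (b r s)].
   The parameter [t] supplies both sources of randomness. *)
exists (fun r t => a (pack (r, unzipl t)) (unzipr t)).
  move=> s1 s2 m1 m2; apply: ja.
    apply: (measurableT_comp (@measurable_pack R)).
    apply/measurable_fun_pairP; split => //.
    exact: measurableT_comp (@measurable_unzipl R) m2.
  exact: measurableT_comp (@measurable_unzipr R) m2.
move=> r; apply: (kleisli_comp_pushf (joint_rand r jb) (hE r)
    (a := fun s u => a (pack (r, s)) u)) => [s1 s2 m1 m2|s].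
  apply: ja => //; apply: (measurableT_comp (@measurable_pack R)).
  by apply/measurable_fun_pairP; split => //; exact: measurable_cst.
by have := kE (pack (r, s)); rewrite /= unpacklK unpackrK.
Qed.

Definition kleisli : qbs_kernel X Z := @QbsHom R X (qbs_P Z) _ kleisli_homP.

Lemma kleisliE (x : X) : (kleisli x : prob Z) = kleisli_comp k h x :> (set Z -> \bar R).
Proof. by []. Qed.

End Composition.

Lemma kernel_eq X Y (k l : qbs_kernel X Y) :
  (forall x U, qbs_measurable U -> (k x : prob Y) U = (l x : prob Y) U) -> k = l.
Proof.
move=> kl; apply: qbs_hom_eq; apply/funext => x; apply: prob_ext => U.
exact: kl.
Qed.

(** Both sides integrate [l (a s u) U]: the left along the pair [unzipl], [unzipr], hence over the
    product measure, the right as an iterated integral. *)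
Lemma kleisliA X Y Z W (l : qbs_kernel Z W) (k : qbs_kernel Y Z)
  (h : qbs_kernel X Y) : kleisli l (kleisli k h) = kleisli (kleisli l k) h.
Proof.
apply: kernel_eq => x U mU.
have [alpha ra hE] := probP (h x : prob Y).
have /rand_qbs_P[a ja kE] := qbs_homP k ra.
have rg : rand (fun t => a (unzipl t) (unzipr t)).
  by apply: ja; [exact: measurable_unzipl|exact: measurable_unzipr].
rewrite !kleisliE.
rewrite (kleisli_compE (h := kleisli k h) l rg (kleisli_comp_pushf ra hE ja kE) mU).
rewrite (kleisli_compE (kleisli l k) ra hE mU).
pose g (z : I * I) := (l (a z.1 z.2) : prob W) U.
have mg : measurable_fun setT g by exact: measurable_kernel_joint.
have g0 z : (0 <= g z)%E by exact: prob_ge0.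
transitivity (\int[mpushforward upsilon (@measurable_unzip R)]_z g z)%E.
  by rewrite (ge0_integral_pushforward (@measurable_unzip R)).
transitivity (\int[(upsilon \x upsilon)%E]_z g z)%E.
  apply: eq_measure_integral => A mA _.
  by rewrite [RHS]upsilon_unzip.
rewrite (@fubini_tonelli1 _ _ _ _ _ upsilon upsilon g mg g0); apply: eq_integral => s _.
by rewrite kleisliE (kleisli_compE (x := alpha s) l (joint_rand s ja) (kE s) mU).
Qed.

Lemma kleisli_delta_pushf X Y Z (f : qbs_hom Y Z) (h : qbs_kernel X Y) (x : X)
    (alpha : I -> Y) :
  rand alpha -> (h x : prob Y) = pushf alpha :> (set Y -> \bar R) ->
  kleisli_comp (delta f) h x = pushf (f \o alpha).
Proof.
move=> ra hE; apply/funext => U.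
have [mU|nU] := pselect (qbs_measurable U); last first.
  by rewrite /kleisli_comp /pushf; case: pselect.
rewrite (kleisli_compE _ ra hE mU) pushfE//.
under eq_integral do rewrite dirac_probE//.
have mV : measurable ((f \o alpha) @^-1` U).
  by apply: mU; exact: qbs_homP.
rewrite (eq_integral (fun r => (\1_((f \o alpha) @^-1` U) r)%:E))//.
by rewrite integral_indic// setIT.
Qed.

Lemma kleisli_delta X Y Z (k : qbs_kernel Y Z) (f : qbs_hom X Y) (x : X) :
  kleisli k (delta f) x = k (f x).
Proof.
apply: prob_ext => U mU; rewrite kleisliE.
rewrite (kleisli_compE (h := delta f) (x := x) k (rand_cst (f x)) erefl mU).
rewrite integral_cst//; apply: etrans (mule1 _).
by congr (_ * _)%E; exact: upsilon_setT.
Qed.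

Lemma kleisli_idr X Y (k : qbs_kernel X Y) : kleisli k (delta (qbs_id X)) = k.
Proof. by apply: kernel_eq => x U mU; rewrite kleisli_delta. Qed.

Lemma kleisli_idl X Y (k : qbs_kernel X Y) : kleisli (delta (qbs_id Y)) k = k.
Proof.
apply: kernel_eq => x U mU; have [alpha ra kE] := probP (k x : prob Y).
by rewrite kleisliE (kleisli_delta_pushf _ ra kE) kE.
Qed.

Lemma kleisli_deltas X Y Z (g : qbs_hom Y Z) (f : qbs_hom X Y) :
  kleisli (delta g) (delta f) = delta (qbs_comp g f).
Proof. by apply: kernel_eq => x U mU; rewrite kleisli_delta. Qed.

Section KernelsOver.
Variable B : qbs R.

Lemma kernel_over_eq (E E' : bundle B) (k l : kernel_over E E') :
  okernel k = okernel l -> k = l.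
Proof.
case: k l => [k pk] [l pl] /= kl; case: _ / kl pl => pl.
by rewrite (Prop_irrelevance pk pl).
Qed.

Lemma kernel_overP (E E' : bundle B) (k : qbs_kernel E E') :
  kleisli_comp (delta (bundle_proj E')) k =
    (fun x => delta (bundle_proj E) x : prob B) <->
  kleisli (delta (bundle_proj E')) k = delta (bundle_proj E).
Proof.
split=> [h|h]; last by apply/funext => x; rewrite -h.
by apply: kernel_eq => x U mU; rewrite kleisliE h.
Qed.

Lemma delta_over_subproof (E E' : bundle B) (f : qbs_hom E E') :
  qbs_comp (bundle_proj E') f = bundle_proj E ->
  kleisli_comp (delta (bundle_proj E')) (delta f) =
    (fun x => delta (bundle_proj E) x : prob B).
Proof. by move=> fE; apply/kernel_overP; rewrite kleisli_deltas fE. Qed.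

Definition delta_over (E E' : bundle B) (f : qbs_hom E E')
    (fE : qbs_comp (bundle_proj E') f = bundle_proj E) : kernel_over E E' :=
  KernelOver (delta_over_subproof fE).

Definition kover_id (E : bundle B) : kernel_over E E :=
  @delta_over E E (qbs_id E) (qbs_idr _).

Lemma kover_comp_subproof (E E' E'' : bundle B) (k : kernel_over E' E'')
    (h : kernel_over E E') :
  kleisli_comp (delta (bundle_proj E'')) (kleisli k h) =
    (fun x => delta (bundle_proj E) x : prob B).
Proof.
apply/kernel_overP; rewrite kleisliA.
by rewrite ((kernel_overP _).1 (okernelP k)) ((kernel_overP _).1 (okernelP h)).
Qed.

Definition kover_comp (E E' E'' : bundle B) (k : kernel_over E' E'')
    (h : kernel_over E E') : kernel_over E E'' :=
  KernelOver (kover_comp_subproof k h).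

Lemma kover_idl (E E' : bundle B) (k : kernel_over E E') :
  kover_comp (kover_id E') k = k.
Proof. by apply: kernel_over_eq; exact: kleisli_idl. Qed.

Lemma kover_idr (E E' : bundle B) (k : kernel_over E E') :
  kover_comp k (kover_id E) = k.
Proof. by apply: kernel_over_eq; exact: kleisli_idr. Qed.

Lemma kover_compA (E1 E2 E3 E4 : bundle B) (l : kernel_over E3 E4)
    (k : kernel_over E2 E3) (h : kernel_over E1 E2) :
  kover_comp l (kover_comp k h) = kover_comp (kover_comp l k) h.
Proof. by apply: kernel_over_eq; exact: kleisliA. Qed.

Definition kernel_over_category : category_on (@kernel_over R B) :=
  @CategoryOn (bundle B) (@kernel_over R B) kover_id kover_comp
    kover_idl kover_idr kover_compA.

Lemma is_kleisli_kernel_over : is_kleisli kernel_over_category.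
Proof. by []. Qed.

End KernelsOver.

End Kleisli.

(** * Fibrewise restriction of kernels over a base with measurable diagonal *)

Section Restriction.
Variable R : realType.
Local Notation I := (unit_itv R).
Local Notation upsilon := (@upsilon R).
Implicit Types X Y Z : qbs R.

Lemma upsilon_full (M A A' : set I) : measurable M -> measurable A ->
  measurable A' -> upsilon M = 1%E -> A `&` M = A' `&` M ->
  upsilon A = upsilon A'.
Proof.
move=> mM mA mA' M1 AA'.
have MC : upsilon (~` M) = 0%E.
  have -> : upsilon (~` M) = (1 - upsilon M)%E by exact: probability_setC.
  by rewrite M1 subee.
have full C : measurable C -> upsilon C = upsilon (C `&` M).
  move=> mC; rewrite (measureDI upsilon mC mM) -[RHS]add0e; congr (_ + _)%E.
  apply/eqP; rewrite -measure_le0 -MC; apply: le_upsilon.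
  - exact: measurableD.
  - exact: measurableC.
  - by move=> x [].
by rewrite full// AA' -full.
Qed.

(** Gluing takes a countable partition, so [S] and its complement are padded with empty sets. *)
Lemma rand_if X (S : set I) (a a' : I -> X) : measurable S ->
  rand a -> rand a' -> rand (fun r => if `[< S r >] then a r else a' r).
Proof.
move=> mS ra ra'.
apply: (rand_glue
  (S := fun n => if n is 0%N then S else if n is 1%N then ~` S else set0)
  (alpha := fun n => if n is 0%N then a else a')).
- by move=> [|[|n]]; [|exact: measurableC|exact: measurable0].
- apply/trivIsetP => -[|[|i]] [|[|j]] // _ _ _;
  by rewrite ?setICl ?setICr ?set0I ?setI0.
- apply/seteqP; split=> // r _; have [Sr|nSr] := pselect (S r).
    by exists 0%N.
  by exists 1%N.
- by move=> [|n].
- move=> [|[|n]] r //= Sr; case: asboolP => //.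
Qed.

Lemma joint_if X (W : set (I * I)) (a a' : I -> I -> X) : measurable W ->
  joint a -> joint a' ->
  joint (fun r s => if `[< W (r, s) >] then a r s else a' r s).
Proof.
move=> mW ja ja' s1 s2 m1 m2.
apply: (rand_if (S := [set r | W (s1 r, s2 r)])); [|exact: ja|exact: ja'].
have m12 : measurable_fun setT (fun r => (s1 r, s2 r)).
  exact/measurable_fun_pairP.
by have := m12 measurableT _ mW; rewrite setTI.
Qed.

Section Diagonal.
Variables (B : qbs R) (dB : diag_measurable B).

Lemma measurable_joint_eq (a a' : I -> I -> B) : joint a -> joint a' ->
  measurable [set z : I * I | a z.1 z.2 = a' z.1 z.2].
Proof.
move=> ja ja'.
apply: (measurable_joint (X := qbs_prod B B) (a := fun r s => (a r s, a' r s))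
  (U := [set z | z.1 = z.2])) => // s1 s2 m1 m2.
by split; [exact: ja|exact: ja'].
Qed.

Lemma measurable_rand_eq (a a' : I -> B) : rand a -> rand a' ->
  measurable [set r | a r = a' r].
Proof. by move=> ra ra'; apply: (dB (alpha := fun r => (a r, a' r))); split. Qed.

Lemma qbs_measurable_set1 (x : B) : qbs_measurable [set y | y = x].
Proof. by move=> a ra; apply: measurable_rand_eq => //; exact: rand_cst. Qed.

(** The equation of a kernel over [B] is evaluated at the singleton of the base point, which is
    measurable by [dB]: any representative lies almost surely in the fibre. *)
Lemma kernel_over_pushf (E E' : bundle B) (k : kernel_over E E') (e : E)
    (alpha : I -> E') :
  rand alpha -> (k e : prob E') = pushf alpha :> (set E' -> \bar R) ->
  upsilon [set r | bundle_proj E' (alpha r) = bundle_proj E e] = 1%E.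
Proof.
move=> ra kE; have mU := qbs_measurable_set1 (bundle_proj E e).
have := congr1 (fun f => f e [set y | y = bundle_proj E e]) (okernelP k).
rewrite /= (kleisli_delta_pushf _ ra kE) pushfE// => h; apply: etrans h _.
by apply: etrans (dirac_probE _ mU) _; rewrite indicE mem_set.
Qed.

Variables (J : qbs R) (b : qbs_hom J B).

Definition slice (E : bundle B) (j : J) (U : set (fibre_tot b E)) : set E :=
  [set e | exists p : b j = bundle_proj E e,
     U (exist (fun je : J * E => b je.1 = bundle_proj E je.2) (j, e) p)].

(** [U] can only be tested on random elements of the fibre, so where [g] leaves the fibre it is
    replaced by a fixed value [g r0] inside it. If [g] never meets the fibre, the preimage is
    empty. *)
Lemma qbs_measurable_slice (E : bundle B) (j : J) (U : set (fibre_tot b E)) :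
  qbs_measurable U -> qbs_measurable (slice j U).
Proof.
move=> mU g rg.
pose S := [set r | b j = bundle_proj E (g r)].
have mS : measurable S.
  apply: measurable_rand_eq; first exact: rand_cst.
  exact: (qbs_homP (bundle_proj E) rg).
have [[r0 Sr0]|nS] := pselect (exists r, S r); last first.
  rewrite (_ : _ @^-1` _ = set0)//; apply/seteqP; split=> // r [p _].
  by apply: nS; exists r.
pose g' r := if `[< S r >] then g r else g r0.
have rg' : rand g' by apply: rand_if => //; exact: rand_cst.
have fib r : b j = bundle_proj E (g' r) by rewrite /g'; case: asboolP.
pose rho r : fibre_tot b E :=
  exist (fun je : J * E => b je.1 = bundle_proj E je.2) (j, g' r) (fib r).
have rr : rand rho by split => //; exact: rand_cst.
have := measurableI _ _ mS (mU _ rr); congr (measurable _).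
have rhoE r (p : b j = bundle_proj E (g r)) : S r ->
    rho r = exist (fun je : J * E => b je.1 = bundle_proj E je.2) (j, g r) p.
  move=> Sr; apply: eq_exist => /=; rewrite /g'; case: asboolP => //.
apply/seteqP; split=> r /=.
  by move=> [Sr]; rewrite (rhoE _ Sr)// => Ur; exists Sr.
by move=> [p Ur]; split=> //; rewrite (rhoE _ p p).
Qed.

Section RestrictedKernel.
Variables (E E' : bundle B) (k : kernel_over E E').

(** Slicing involves no choice of representative, which makes compatibility with composition a
    computation; [restr_fun_pushf] recovers the description by random elements. *)
Definition restr_fun (x : fibre_tot b E) (U : set (fibre_tot b E')) : \bar R :=
  if pselect (qbs_measurable U) then
    (k (fibre_snd b E x) : prob E') (slice (fibre_fst b E x) U)
  else 0%E.

Lemma restr_fun_pushf (x : fibre_tot b E) (alpha : I -> E')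
    (fib : forall r, b (fibre_fst b E x) = bundle_proj E' (alpha r)) :
  (k (fibre_snd b E x) : prob E') = pushf alpha :> (set E' -> \bar R) ->
  restr_fun x = @pushf R (fibre_tot b E')
    (fun r => exist _ (fibre_fst b E x, alpha r) (fib r)).
Proof.
move=> kE; apply/funext => U; rewrite /restr_fun /pushf.
case: pselect => //= mU; rewrite kE pushfE; last exact: qbs_measurable_slice.
congr (Defs.upsilon _); apply/seteqP; split=> r /=.
  by move=> [p]; rewrite (Prop_irrelevance p (fib r)).
by move=> Ur; exists (fib r).
Qed.

(* The points where a representative [a] of [k] leaves the fibre form a null
   set in each section; there it is replaced by a measurably chosen value of
   [a] in the same fibre. *)
Lemma kernel_over_lift (rho : I -> fibre_tot b E) : rand rho ->
  exists a : I -> I -> E', [/\ joint a,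
    forall r s, b (fibre_fst b E (rho r)) = bundle_proj E' (a r s) &
    forall r, (k (fibre_snd b E (rho r)) : prob E') = pushf (a r)
      :> (set E' -> \bar R)].
Proof.
move=> rr; have rE := qbs_homP (fibre_snd b E) rr.
have rJ := qbs_homP (qbs_comp b (fibre_fst b E)) rr.
have /rand_qbs_P[a ja kE] := qbs_homP (okernel k) rE.
pose M := [set z : I * I |
  bundle_proj E' (a z.1 z.2) = b (fibre_fst b E (rho z.1))].
have mM : measurable M.
  apply: (measurable_joint_eq (a := fun r s => bundle_proj E' (a r s))
    (a' := fun r _ => b (fibre_fst b E (rho r)))); first exact: joint_hom.
  by move=> s1 s2 m1 _; exact: (rand_comp m1 rJ).
have M1 r : upsilon (xsection M r) = 1%E.
  rewrite -(kernel_over_pushf (joint_rand r ja) (kE r)); congr (Defs.upsilon _).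
  apply/seteqP; split=> s; rewrite /xsection /= inE /M /=;
  by rewrite [b _](svalP (rho r)).
have [sel msel selM] := measurable_selection mM M1.
pose a' r s := if `[< M (r, s) >] then a r s else a r (sel r).
have ja' : joint a'.
  apply: joint_if => // s1 s2 m1 m2; apply: ja => //.
  exact: measurableT_comp msel m1.
exists a'; split=> // [r s|r].
  by apply/esym; rewrite /a'; case: asboolP => // _; exact: selM.
rewrite [LHS]kE; apply/funext => U.
have [mU|nU] := pselect (qbs_measurable U); last first.
  by rewrite /pushf; case: pselect.
rewrite !pushfE//; apply: (upsilon_full (M := xsection M r)) => //.
- exact: measurable_xsection.
- by apply: mU; exact: joint_rand.
- by apply: mU; exact: joint_rand.
- apply/seteqP; split=> s [Us Ms]; split=> //; move: Us => /=;
  by rewrite /a'; case: asboolP => // nM; have /xsectionP := Ms.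
Qed.

(** The lift along a constant random element, evaluated at an arbitrary parameter. *)
Lemma kernel_over_lift1 (x : fibre_tot b E) :
  exists (alpha : I -> E')
         (fib : forall r, b (fibre_fst b E x) = bundle_proj E' (alpha r)),
  rand alpha /\ (k (fibre_snd b E x) : prob E') = pushf alpha
    :> (set E' -> \bar R).
Proof.
have [a [ja fib kE]] := kernel_over_lift (rand_cst x).
by exists (a point), (fib point); split; [exact: joint_rand|exact: kE].
Qed.

Lemma restr_subproof (x : fibre_tot b E) :
  exists2 alpha, rand alpha & restr_fun x = pushf alpha.
Proof.
have [alpha [fib [ra kE]]] := kernel_over_lift1 x.
eexists; last exact: (restr_fun_pushf fib kE).
by split => //=; exact: rand_cst.
Qed.

Definition restr_prob (x : fibre_tot b E) : prob (fibre_tot b E') :=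
  Prob (restr_subproof x).

Lemma restr_homP (rho : I -> fibre_tot b E) :
  rand rho -> rand (q := qbs_P (fibre_tot b E')) (restr_prob \o rho).
Proof.
move=> rr; have [a [ja fib kE]] := kernel_over_lift rr.
apply/rand_qbs_P.
exists (fun r s => exist (fun je : J * E' => b je.1 = bundle_proj E' je.2)
  (fibre_fst b E (rho r), a r s) (fib r s)).
  move=> s1 s2 m1 m2; split; last exact: ja.
  exact: (rand_comp m1 (qbs_homP (fibre_fst b E) rr)).
by move=> r; exact: restr_fun_pushf.
Qed.

Definition restr_hom : qbs_kernel (fibre_tot b E) (fibre_tot b E') :=
  @QbsHom R (fibre_tot b E) (qbs_P (fibre_tot b E')) _ restr_homP.

Lemma restr_overP :
  kleisli_comp (delta (bundle_proj (fibre b E'))) restr_hom =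
    (fun x => delta (bundle_proj (fibre b E)) x : prob J).
Proof.
apply/funext => x; have [alpha [fib [ra kE]]] := kernel_over_lift1 x.
rewrite (kleisli_delta_pushf (h := restr_hom) (x := x) _ _
  (restr_fun_pushf fib kE))//.
by split => //=; exact: rand_cst.
Qed.

Definition restr : kernel_over (fibre b E) (fibre b E') :=
  @KernelOver R J (fibre b E) (fibre b E') restr_hom restr_overP.

Lemma restr_pushf (x : fibre_tot b E) (alpha : I -> E')
    (fib : forall r, b (fibre_fst b E x) = bundle_proj E' (alpha r)) :
  (k (fibre_snd b E x) : prob E') = pushf alpha :> (set E' -> \bar R) ->
  (restr x : prob (fibre_tot b E')) = @pushf R (fibre_tot b E')
    (fun r => exist _ (fibre_fst b E x, alpha r) (fib r))
    :> (set (fibre_tot b E') -> \bar R).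
Proof. exact: restr_fun_pushf. Qed.

Lemma is_restriction_restr : is_restriction k restr.
Proof.
move=> x; have [alpha [fib [ra kE]]] := kernel_over_lift1 x.
by exists alpha, fib; split=> //; exact: restr_pushf.
Qed.

End RestrictedKernel.

(** With a representative of [h] inside the fibre, both sides become the integral of the mass that
    [k] gives to the slice of [U]. *)
Lemma restr_comp (E E' E'' : bundle B) (k : kernel_over E' E'')
    (h : kernel_over E E') :
  restr (kover_comp k h) = kover_comp (restr k) (restr h).
Proof.
apply: kernel_over_eq; apply: kernel_eq => x U mU.
have [alpha [fib [ra hE]]] := kernel_over_lift1 h x.
have mV := qbs_measurable_slice (fibre_fst b E x) mU.
have rr : rand (fun r => exist _ (fibre_fst b E x, alpha r) (fib r) : fibre_tot b E').
  by split => //=; exact: rand_cst.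
apply/esym.
apply: etrans (kleisli_compE (h := okernel (restr h)) (x := x)
  (okernel (restr k)) rr (restr_pushf fib hE) mU) _.
transitivity (kleisli_comp k h (fibre_snd b E x) (slice (fibre_fst b E x) U)).
  rewrite (kleisli_compE _ ra hE mV); apply: eq_integral => r _.
  by rewrite /= /restr_fun; case: pselect.
by rewrite /= /restr_fun; case: pselect.
Qed.

Section FibreMap.
Variables (E E' : bundle B) (f : qbs_hom E E').
Hypothesis fE : qbs_comp (bundle_proj E') f = bundle_proj E.

Lemma fibre_map_subproof (x : fibre_tot b E) :
  b (sval x).1 = bundle_proj E' (f (sval x).2).
Proof.
apply: etrans (svalP x) _.
by have := congr1 (fun g : qbs_hom E B => g (sval x).2) fE.
Qed.

Definition fibre_map_fun (x : fibre_tot b E) : fibre_tot b E' :=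
  exist (fun je : J * E' => b je.1 = bundle_proj E' je.2)
    ((sval x).1, f (sval x).2) (fibre_map_subproof x).

Lemma fibre_map_homP (rho : I -> fibre_tot b E) :
  rand rho -> rand (fibre_map_fun \o rho).
Proof. by move=> [r1 r2]; split=> //; exact: (qbs_homP f r2). Qed.

Definition fibre_map : qbs_hom (fibre_tot b E) (fibre_tot b E') :=
  QbsHom fibre_map_homP.

(** A constant function represents the Dirac measure and already stays in the fibre, because [f]
    lies over [B]. Coherence laws thereby reduce to functions. *)
Lemma restr_delta (k : kernel_over E E') : okernel k = delta f ->
  okernel (restr k) = delta fibre_map.
Proof.
move=> kE; apply: kernel_eq => x U mU.
have fib r : b (fibre_fst b E x) = bundle_proj E' ((fun _ : I => f (fibre_snd b E x)) r).
  exact: fibre_map_subproof.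
rewrite (restr_pushf (k := k) fib) ?kE//=; congr (pushf _ _).
by apply/funext => r; apply: eq_exist.
Qed.

End FibreMap.

End Diagonal.
End Restriction.

(** * The fibration given by the Grothendieck construction *)

(** Proof irrelevance turns the equation between first components into reflexivity, so the second
    components are compared without transport. *)
Lemma existT_inj (T : Type) (P : T -> Type) (x : T) (p q : P x) :
  existT P x p = existT P x q -> p = q.
Proof.
move=> e; have := projT2_eq e; rewrite /=.
by rewrite (Prop_irrelevance (projT1_eq e) erefl).
Qed.

Section GrothendieckFibration.
Variables (C : category) (F0 : opcat C -> category).
Variable Fo : forall x y : opcat C, mor x y -> F0 x -> F0 y.
Variable F : pseudofunctor_on Fo.

(** The lift of [u] has the reindexed object as source and an identity as vertical part. Composing
    with it amounts to composing with a component of [ps_mult], whose inverse gives existence and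
    uniqueness of the factorisation. *)
Lemma groth_proj_fibration : is_fibration (groth_proj F).
Proof.
move=> Y b u.
pose X : groth F := existT _ b (@Fo (projT1 Y) b u (projT2 Y)).
pose f : @mor (groth F) X Y := existT _ u (idm (@Fo (projT1 Y) b u (projT2 Y))).
exists X, erefl, f; split; first by rewrite /= comp_idr.
move=> Z [g1 g2] v hv; have {}hv : u \oc v = g1 := hv.
case: _ / hv g2 => g2.
have [m [mK Km]] := nat_cpt_iso
  (@ps_mult _ _ _ F (projT1 Y) b (projT1 Z) v u) (projT2 Y).
exists (existT _ v (m \oc g2)); split.
  split=> //; congr existT.
  by rewrite fmap_id comp_idl Defs.compA Km comp_idl.
move=> [v' k] [v'v]; have {}v'v : v' = v := v'v.
subst v' => fk; have := existT_inj fk; rewrite fmap_id comp_idl => <-.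
by rewrite Defs.compA mK comp_idl.
Qed.

End GrothendieckFibration.

(** * The pseudofunctor of kernels: comparison isomorphisms and coherence *)

Section KernelPseudofunctor.
Variable R : realType.
Local Notation I := (unit_itv R).

Lemma delta_eq (X Y : qbs R) (f g : qbs_hom X Y) : f =1 g -> delta f = delta g.
Proof. by move=> /funext fg; congr delta; exact: qbs_hom_eq. Qed.

Lemma restr_id (B J : qbs R) (dB : diag_measurable B) (b : qbs_hom J B)
  (E : bundle B) : restr dB b (kover_id E) = kover_id (fibre b E).
Proof.
apply: kernel_over_eq.
rewrite (restr_delta dB b (f := qbs_id E) (qbs_idr _))//.
by apply: delta_eq => -[[j e] p]; exact: eq_exist.
Qed.

Lemma fibre_id_over (B : qbs R) (E : bundle B) :
  qbs_comp (bundle_proj (fibre (qbs_id B) E)) (fibre_id E) = bundle_proj E.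
Proof. exact: qbs_hom_eq. Qed.

Lemma fibre_snd_over (B : qbs R) (E : bundle B) :
  qbs_comp (bundle_proj E) (fibre_snd (qbs_id B) E) =
  bundle_proj (fibre (qbs_id B) E).
Proof. by apply: qbs_hom_eq; apply/funext => x; exact: esym (svalP x). Qed.

Lemma fibre_comp_over (B J L : qbs R) (b : qbs_hom J B) (c : qbs_hom L J)
    (E : bundle B) :
  qbs_comp (bundle_proj (fibre (qbs_comp b c) E)) (fibre_comp b c E) =
  bundle_proj (fibre c (fibre b E)).
Proof. exact: qbs_hom_eq. Qed.

Section FibreUncomp.
Variables (B J L : qbs R) (b : qbs_hom J B) (c : qbs_hom L J) (E : bundle B).

(** The point of [J] forgotten by [fibre_comp] is recovered as the image under [c] of the point of
    [L]. *)
Definition fibre_uncomp_fun (x : fibre_tot (qbs_comp b c) E) :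
    fibre_tot c (fibre b E) :=
  exist (fun le : L * fibre b E => c le.1 = bundle_proj (fibre b E) le.2)
    ((sval x).1, exist (fun je : J * E => b je.1 = bundle_proj E je.2)
       (c (sval x).1, (sval x).2) (svalP x)) erefl.

Lemma fibre_uncomp_homP (rho : I -> fibre_tot (qbs_comp b c) E) :
  rand rho -> rand (fibre_uncomp_fun \o rho).
Proof. by move=> [r1 r2]; split=> //; split=> //; exact: (qbs_homP c r1). Qed.

Definition fibre_uncomp : qbs_hom (fibre_tot (qbs_comp b c) E)
    (fibre_tot c (fibre b E)) := QbsHom fibre_uncomp_homP.

Lemma fibre_uncomp_over : qbs_comp (bundle_proj (fibre c (fibre b E))) fibre_uncomp
  = bundle_proj (fibre (qbs_comp b c) E).
Proof. exact: qbs_hom_eq. Qed.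

Lemma fibre_compK (x : fibre_tot c (fibre b E)) :
  fibre_uncomp (fibre_comp b c E x) = x.
Proof.
case: x => [[l [[j e] p]] /= q]; apply: eq_exist => /=; congr pair.
by apply: eq_exist; rewrite /= q.
Qed.

Lemma fibre_uncompK (x : fibre_tot (qbs_comp b c) E) :
  fibre_comp b c E (fibre_uncomp x) = x.
Proof. by case: x => [[l e] p]; exact: eq_exist. Qed.

End FibreUncomp.

(** A representative of [k] that stays in the fibre represents both sides by one and the same
    function. *)
Lemma fibre_id_natural (B : qbs R) (dB : diag_measurable B) (E E' : bundle B)
    (k : kernel_over E E') :
  kleisli (delta (fibre_id E')) k =
  kleisli (restr dB (qbs_id B) k) (delta (fibre_id E)).
Proof.
apply: kernel_eq => e U mU; rewrite kleisli_delta.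
have [alpha [fib [ra kE]]] := kernel_over_lift1 dB k (fibre_id E e).
rewrite (restr_pushf dB fib kE) kleisliE (kleisli_delta_pushf _ ra kE).
by congr (pushf _ _); apply/funext => r; apply: eq_exist => /=; rewrite -fib.
Qed.

(** One representative [alpha] of [k] in the fibre is restricted twice on the left and once, along
    the composite, on the right; [fibre_comp] removes the intermediate coordinate. *)
Lemma fibre_comp_natural (B J L : qbs R) (dB : diag_measurable B)
    (dJ : diag_measurable J) (b : qbs_hom J B) (c : qbs_hom L J)
    (E E' : bundle B) (k : kernel_over E E') :
  kleisli (delta (fibre_comp b c E')) (restr dJ c (restr dB b k)) =
  kleisli (restr dB (qbs_comp b c) k) (delta (fibre_comp b c E)).
Proof.
apply: kernel_eq => x U mU; rewrite kleisli_delta.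
have [alpha [fib [ra kE]]] := kernel_over_lift1 dB k (sval x).2.
have kbE := restr_pushf dB fib kE.
have fibc r : c (fibre_fst c (fibre b E) x) = bundle_proj (fibre b E')
    (exist (fun je : J * E' => b je.1 = bundle_proj E' je.2)
      (fibre_fst b E (sval x).2, alpha r) (fib r)) := svalP x.
have kcE := restr_pushf dJ (k := restr dB b k) fibc kbE.
have fibbc r : qbs_comp b c (fibre_fst (qbs_comp b c) E (fibre_comp b c E x)) =
    bundle_proj E' (alpha r).
  by rewrite -fib /=; congr (b _); exact: (svalP x).
rewrite (restr_pushf dB (x := fibre_comp b c E x) fibbc kE) kleisliE.
rewrite (kleisli_delta_pushf (h := restr dJ c (restr dB b k)) (x := x) _ _ kcE).
  by congr (pushf _ _); apply/funext => r; exact: eq_exist.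
by split; [exact: rand_cst|split; [exact: rand_cst|]].
Qed.

Definition unit_over (B : qbs R) (E : bundle B) :
    kernel_over E (fibre (qbs_id B) E) :=
  delta_over (fibre_id_over E).

Definition unit_over_inv (B : qbs R) (E : bundle B) :
    kernel_over (fibre (qbs_id B) E) E :=
  @delta_over R B (fibre (qbs_id B) E) E _ (fibre_snd_over E).

Definition mult_over (B J L : qbs R) (b : qbs_hom J B) (c : qbs_hom L J)
    (E : bundle B) :
    kernel_over (fibre c (fibre b E)) (fibre (qbs_comp b c) E) :=
  @delta_over R L (fibre c (fibre b E)) (fibre (qbs_comp b c) E) _
    (fibre_comp_over b c E).

Definition mult_over_inv (B J L : qbs R) (b : qbs_hom J B) (c : qbs_hom L J)
    (E : bundle B) :
    kernel_over (fibre (qbs_comp b c) E) (fibre c (fibre b E)) :=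
  @delta_over R L (fibre (qbs_comp b c) E) (fibre c (fibre b E)) _
    (fibre_uncomp_over b c E).

Let K0 (B : opcat (dQBS R)) : category :=
  Category (kernel_over_category (sval B)).
Let Ko (B J : opcat (dQBS R)) (b : mor B J) (E : K0 B) : K0 J :=
  @fibre R (sval B) (sval J) b E.

Definition restr_functor (B J : opcat (dQBS R)) (b : mor B J) :
    functor_on (@Ko B J b) :=
  @FunctorOn (K0 B) (K0 J) (@Ko B J b)
    (fun E E' k => @restr R (sval B) (svalP B) (sval J) b E E' k)
    (fun E => @restr_id (sval B) (sval J) (svalP B) b E)
    (fun E E' E'' k h => @restr_comp R (sval B) (svalP B) (sval J) b E E' E'' k h).

(** Kept transparent, like [mult_iso], because the coherence laws and the final theorem unfold the
    components to deterministic kernels. *)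
Definition unit_iso (B : opcat (dQBS R)) :
  nat_iso (id_functor (K0 B)) (Functor (restr_functor (idm B))).
Proof.
apply: (@NatIso (K0 B) (K0 B) (id_functor (K0 B)) (Functor (restr_functor (idm B)))
  (fun E => unit_over E)) => [E|E E' k].
- exists (unit_over_inv E).
  split; apply: kernel_over_eq; apply: etrans (kleisli_deltas _ _) _.
    exact: delta_eq.
  by apply: delta_eq => -[[j e] p]; apply: eq_exist => /=; rewrite -p.
- by apply: kernel_over_eq; exact: fibre_id_natural.
Defined.

Definition mult_iso (B J L : opcat (dQBS R)) (c : mor J L) (b : mor B J) :
  nat_iso (comp_functor (Functor (restr_functor c)) (Functor (restr_functor b)))
    (Functor (restr_functor (c \oc b))).
Proof.
apply: (@NatIso (K0 B) (K0 L)
  (comp_functor (Functor (restr_functor c)) (Functor (restr_functor b)))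
  (Functor (restr_functor (c \oc b)))
  (fun E => mult_over b c E)) => [E|E E' k].
- exists (mult_over_inv b c E).
  split; apply: kernel_over_eq; apply: etrans (kleisli_deltas _ _) _.
    by apply: delta_eq => x; exact: fibre_compK.
  by apply: delta_eq => x; exact: fibre_uncompK.
- by apply: kernel_over_eq; exact: fibre_comp_natural.
Defined.

Lemma fibre_cast_subproof (B J : qbs R) (b b' : qbs_hom J B) (e : b = b')
    (E : bundle B) (x : fibre_tot b E) :
  b' (sval x).1 = bundle_proj E (sval x).2.
Proof. by case: _ / e; exact: (svalP x). Qed.

(** Transport along [e], written as a map that fixes the underlying pair, so that coherence can be
    checked pointwise. *)
Definition fibre_cast (B J : qbs R) (b b' : qbs_hom J B) (e : b = b')
    (E : bundle B) : qbs_hom (fibre_tot b E) (fibre_tot b' E) :=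
  @QbsHom R (fibre_tot b E) (fibre_tot b' E)
    (fun x => exist _ (sval x) (fibre_cast_subproof e x)) (fun rho rr => rr).

Lemma ps_eq_delta (B J : opcat (dQBS R)) (b b' : mor B J) (e : b = b') (E : K0 B) :
  okernel (ps_eq Ko e E : kernel_over _ _) = delta (fibre_cast e E).
Proof. by case: _ / e; apply: delta_eq => x; case: x => x p; exact: eq_exist. Qed.

Lemma kernel_unitl (B J : opcat (dQBS R)) (b : mor B J) (E : K0 B) :
  ps_eq Ko (comp_idl b) E \oc (mult_iso (idm J) b E \oc unit_iso J (Ko b E))
  = idm (Ko b E).
Proof.
apply: kernel_over_eq.
transitivity (kleisli (delta (fibre_cast (comp_idl b) E))
  (kleisli (delta (fibre_comp b (qbs_id (sval J)) E)) (delta (fibre_id (fibre b E))))).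
  by rewrite -ps_eq_delta.
rewrite !kleisli_deltas; apply: delta_eq => -[[j e] p]; exact: eq_exist.
Qed.

Lemma kernel_unitr (B J : opcat (dQBS R)) (b : mor B J) (E : K0 B) :
  ps_eq Ko (comp_idr b) E \oc (mult_iso b (idm B) E
    \oc Defs.fmap (Functor (restr_functor b)) (unit_iso B E))
  = idm (Ko b E).
Proof.
apply: kernel_over_eq.
transitivity (kleisli (delta (fibre_cast (comp_idr b) E))
  (kleisli (delta (fibre_comp (qbs_id (sval B)) b E))
    (delta (fibre_map b (fibre_id_over E))))).
  by rewrite -ps_eq_delta
    -(restr_delta (svalP B) b (fibre_id_over E) (k := unit_over E)).
rewrite !kleisli_deltas; apply: delta_eq => -[[j e] p]; exact: eq_exist.
Qed.

Lemma kernel_assoc (B J L M : opcat (dQBS R)) (d : mor L M) (c : mor J L)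
    (b : mor B J) (E : K0 B) :
  ps_eq Ko (Defs.compA d c b) E \oc (mult_iso d (c \oc b) E
    \oc Defs.fmap (Functor (restr_functor d)) (mult_iso c b E))
  = mult_iso (d \oc c) b E \oc mult_iso d c (Ko b E).
Proof.
apply: kernel_over_eq.
have over : qbs_comp (bundle_proj (fibre (qbs_comp b c) E)) (fibre_comp b c E) =
  bundle_proj (fibre c (fibre b E)) := fibre_comp_over b c E.
have restrE : okernel (restr (svalP L) d (mult_over b c E)) =
  delta (@fibre_map R _ _ d (fibre c (fibre b E)) (fibre (qbs_comp b c) E) _ over).
  exact: (@restr_delta R _ (svalP L) _ d (fibre c (fibre b E))
    (fibre (qbs_comp b c) E) _ over).
transitivity (kleisli (delta (fibre_cast (Defs.compA d c b) E))
  (kleisli (delta (fibre_comp (qbs_comp b c) d E))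
    (okernel (restr (svalP L) d (mult_over b c E))))).
  by rewrite -ps_eq_delta.
rewrite restrE.
transitivity (kleisli (delta (fibre_comp b (qbs_comp c d) E))
  (delta (fibre_comp c d (fibre b E)))); last by [].
by rewrite !kleisli_deltas; apply: delta_eq => -[[l [[j e] p]] q]; exact: eq_exist.
Qed.

Definition kernel_pseudofunctor : pseudofunctor_on Ko :=
  @PseudofunctorOn (opcat (dQBS R)) K0 Ko restr_functor unit_iso mult_iso
    kernel_unitl kernel_unitr kernel_assoc.

End KernelPseudofunctor.

Theorem proposition2p9 (R : realType) :
  exists KC : forall B : qbs R, category_on (@kernel_over R B),
    (forall B : qbs R, is_kleisli (KC B)) /\
    exists K : @pseudofunctor_on (opcat (dQBS R))
        (fun B => Category (KC (sval B)))
        (fun B J (b : qbs_hom (sval J) (sval B)) E => fibre b E),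
      [/\ forall (B J : dQBS R) (b : qbs_hom (sval J) (sval B))
              (E E' : bundle (sval B)) (k : kernel_over E E'),
            is_restriction k (@fmap_ _ _ _ (@ps_str _ _ _ K B J b) E E' k),
          forall (B : dQBS R) (E : bundle (sval B)),
            (ps_unit K B E : kernel_over _ _) = delta (fibre_id E)
              :> qbs_hom _ (qbs_P _),
          forall (B J L : dQBS R) (b : qbs_hom (sval J) (sval B))
              (c : qbs_hom (sval L) (sval J)) (E : bundle (sval B)),
            (@ps_mult _ _ _ K B J L c b E : kernel_over _ _)
              = delta (fibre_comp b c E) :> qbs_hom _ (qbs_P _)
        & is_fibration (groth_proj K)].
Proof.
exists (@kernel_over_category R); split; first exact: is_kleisli_kernel_over.
exists (kernel_pseudofunctor R); split=> //; last exact: groth_proj_fibration.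
by move=> B J b E E' k; exact: is_restriction_restr.
Qed.
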